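(* Let $n\ge 1$ and let $A,B$ be $n\times n$ complex matrices. (i) If $A$ and $B$ are positive definite, then for every real $q<0$, $$\operatorname{Tr}(A+B)^q\le \operatorname{Tr}A^q+\operatorname{Tr}B^q+(2^q-2)\operatorname{Tr}\bigl(A^{1/2}BA^{1/2}\bigr)^{q/2}.$$ (ii) If $A$ and $B$ are positive semidefinite, then for every real $q\ge 2$, $$\operatorname{Tr}(A+B)^q\ge \operatorname{Tr}A^q+\operatorname{Tr}B^q+(2^q-2)\operatorname{Tr}\bigl(A^{1/2}BA^{1/2}\bigr)^{q/2}.$$
   Context: All matrices are finite-dimensional complex matrices. $\operatorname{Tr}$ is the usual non-normalized trace, and $\operatorname{Tr}Z^q$ means $\operatorname{Tr}(Z^q)$. Real powers of positive (semi)definite Hermitian matrices are defined by functional calculus (negative powers only for positive definite matrices). *)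

(* Defs.v *)
From HB Require Import structures.
From mathcomp Require Import all_boot all_order all_algebra.
From mathcomp Require Export spectral sesquilinear complex.
From mathcomp Require Import reals exp.

Set Implicit Arguments.
Unset Strict Implicit.
Unset Printing Implicit Defensive.

Import Order.TTheory GRing.Theory Num.Theory.
Local Open Scope ring_scope.
Local Open Scope sesquilinear_scope.
Local Open Scope complex_scope.

(* In the order of R[i], 0 <= z (resp. 0 < z) means that z is real and
   nonnegative (resp. positive). *)
Definition posdefmx (R : realType) (n : nat) (A : 'M[R[i]]_n) : Prop :=
  A \is hermsymmx /\
  forall v : 'cV[R[i]]_n, v != 0 -> 0 < (v ^t* *m A *m v) 0 0.

Definition possemidefmx (R : realType) (n : nat) (A : 'M[R[i]]_n) : Prop :=
  A \is hermsymmx /\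
  forall v : 'cV[R[i]]_n, 0 <= (v ^t* *m A *m v) 0 0.

(* Functional calculus, meaningful for A Hermitian: then spectralmx A is
   unitary, A = (spectralmx A)^-1 *m diag_mx (spectral_diag A) *m spectralmx A
   and the entries of spectral_diag A are real, so that f is applied to the
   eigenvalues themselves. *)
Definition hermfun (R : realType) (n : nat) (f : R -> R) (A : 'M[R[i]]_n) :
    'M[R[i]]_n :=
  invmx (spectralmx A)
    *m diag_mx (map_mx (fun z : R[i] => (f (complex.Re z))%:C) (spectral_diag A))
    *m spectralmx A.

(* The convention of powR is 0 `^ 0 = 1 and 0 `^ q = 0 for q != 0; negative
   powers are only meaningful for positive definite A. *)
Definition mxpowR (R : realType) (n : nat) (A : 'M[R[i]]_n) (q : R) :
    'M[R[i]]_n :=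
  hermfun (fun x : R => x `^ q) A.

(* Main.v *)
(* Traces are compared through diagonal entries in well-chosen orthonormal bases
   (Peierls: sum_k f(<e_k|A|e_k>) <= Tr f(A) for convex f).

   (i) Peierls in the eigenbasis of A + B and the convexity of x^q give
   2 Tr (A+B)^q <= 2^q (Tr A^q + Tr B^q), so that, 2^q - 2 being negative, it
   suffices that 2 Tr (A^(1/2) B A^(1/2))^(q/2) <= Tr A^q + Tr B^q.  Passing to
   the inverses makes the exponent p = -q positive.  For p >= 2, AB is put in
   triangular form; for p < 2, Tr K^r <= r Tr (K Z^(r-1)) + (1-r) Tr Z^r (r < 1)
   allows to lower the power of A in B^(t/2) A^s B^(t/2) by one at a time.

   (ii) With X X^* = A and Y Y^* = B the claim [blk] is equivalent, through 2 x 2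
   block matrices, to
     [star]  2 Tr D^q + (2^q - 2) Tr |O|^q <= Tr (D+O)^q + Tr (D-O)^q
   for D + O, D - O >= 0.  For 2 <= q <= 3, [blk] reduces to scalars: in the
   eigenbases of A and B, with w_ij = |<u_i|v_j>|^2, one has
   sum_ij w_ij (a_i + b_j)^q <= Tr (A+B)^q and the Araki-Lieb-Thirring inequality
   Tr (A^(1/2) B A^(1/2))^(q/2) <= sum_ij w_ij (a_i b_j)^(q/2).  For 3 <= q <= 4,
   [star] follows from a Taylor expansion along D + t O.  Finally [star] for s
   implies [star] for 2 s, because (D + O)^2 and (D - O)^2 have half-sum D^2 + O^2
   and half-difference DO + OD. *)

Require Import Defs.
From mathcomp Require Import all_boot all_order all_algebra.
From mathcomp Require Import boolp classical_sets functions.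
From mathcomp Require Import reals topology normedtype sequences derive realfun exp.
From mathcomp Require Import ring lra.

Set Implicit Arguments.
Unset Strict Implicit.
Unset Printing Implicit Defensive.

Import Order.TTheory GRing.Theory Num.Theory.
Import numFieldNormedType.Exports.
Local Open Scope ring_scope.
Local Open Scope sesquilinear_scope.

(** The ranges of exponents come from operator Jensen. Comparing traces in several eigenbases leads
    to double sums over pairs of eigenvalues, with squared matrix elements |<u_i|w_j>|^2 (p_i -
    d_j)^2 as weights and the power q - 2 of a combination of p_i and d_j. The isometry [pairmx]
    turns such a sum into a quadratic form whose compression is diagonal, so x^(q-2) has to be
    operator concave (q - 2 in [0,1]) or operator convex (q - 2 in [1,2]). Together these give
    [2,4], which is what repeated halving of an exponent above 4 reaches. The constant arises from
    an extremal case: |o_k| is at most the k-th diagonal entry of D in the eigenbasis of O, and with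
    |o_k| in place of that entry one finds (|o_k| + o_k)^q + (|o_k| - o_k)^q - 2 |o_k|^q = (2^q - 2)
    |o_k|^q. Doubling reproduces it without loss. Limits are replaced by geometric error terms
    ([le_of_contraction]): the interpolation arguments start from a crude bound and shrink its
    excess by a fixed factor. *)

Local Notation conjC := Num.conj_op.

(* R[i] is only used through this interface: unification of matrix expressions is
   much faster over an abstract field than over the concrete R[i]. *)
Record cplx (R : realType) := Cplx {
  csort :> numClosedFieldType;
  ofR : {rmorphism R -> csort};
  reR : csort -> R;
  ofR_ge0 : forall a, (0 <= ofR a) = (0 <= a);
  ofR_Re : forall z, ofR (reR z) = 'Re z }.

Lemma ofR_inj (R : realType) (C : cplx R) : injective (ofR C).
Proof. exact: fmorph_inj. Qed.

Lemma ofR_le (R : realType) (C : cplx R) a b : (ofR C a <= ofR C b) = (a <= b).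
Proof. by rewrite -subr_ge0 -rmorphB ofR_ge0 subr_ge0. Qed.

Lemma ofR_real (R : realType) (C : cplx R) a : ofR C a \is Num.real.
Proof.
rewrite realE ofR_ge0; have [//|a0] := leP 0 a.
by rewrite -(rmorph0 (ofR C)) ofR_le ltW.
Qed.

Lemma ofR_conj (R : realType) (C : cplx R) a : conjC (ofR C a) = ofR C a.
Proof. exact/CrealP/ofR_real. Qed.

Lemma ofRK (R : realType) (C : cplx R) a : reR (ofR C a) = a.
Proof. apply: (@ofR_inj _ C); rewrite ofR_Re; exact/Creal_ReP/ofR_real. Qed.

Lemma reR_real (R : realType) (C : cplx R) (z : C) :
  z \is Num.real -> ofR C (reR z) = z.
Proof. by move=> zr; rewrite ofR_Re; apply/Creal_ReP. Qed.

Lemma reRD (R : realType) (C : cplx R) (z w : C) : reR (z + w) = reR z + reR w.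
Proof. by apply: (@ofR_inj _ C); rewrite rmorphD !ofR_Re raddfD. Qed.

Lemma reRM (R : realType) (C : cplx R) a (z : C) : reR (ofR C a * z) = a * reR z.
Proof.
by apply: (@ofR_inj _ C); rewrite rmorphM !ofR_Re ReMl // ofR_real.
Qed.

Lemma reR_conj (R : realType) (C : cplx R) (z : C) : reR (conjC z) = reR z.
Proof. by apply: (@ofR_inj _ C); rewrite !ofR_Re Re_conj. Qed.

Lemma reR_sum (R : realType) (C : cplx R) I (r : seq I) P (F : I -> C) :
  reR (\sum_(i <- r | P i) F i) = \sum_(i <- r | P i) reR (F i).
Proof.
apply: (big_morph _ (@reRD R C)); apply: (@ofR_inj _ C).
by rewrite ofR_Re raddf0 rmorph0.
Qed.

Definition sqn (R : realType) (C : cplx R) (z : C) : R := reR (`|z| ^+ 2).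

Lemma sqnE (R : realType) (C : cplx R) (z : C) : ofR C (sqn z) = conjC z * z.
Proof. by rewrite reR_real ?normCKC // -normCKC ger0_real ?exprn_ge0. Qed.

Lemma sqn_ge0 (R : realType) (C : cplx R) (z : C) : 0 <= sqn z.
Proof. by rewrite -(ofR_ge0 C) sqnE -normCKC exprn_ge0. Qed.

Lemma sqnM (R : realType) (C : cplx R) (z w : C) : sqn (z * w) = sqn z * sqn w.
Proof. by apply: (@ofR_inj _ C); rewrite rmorphM !sqnE rmorphM mulrACA. Qed.

Lemma sqn_conj (R : realType) (C : cplx R) (z : C) : sqn (conjC z) = sqn z.
Proof. by apply: (@ofR_inj _ C); rewrite !sqnE conjCK mulrC. Qed.

Lemma sqnR (R : realType) (C : cplx R) a : sqn (ofR C a) = a ^+ 2.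
Proof. by apply: (@ofR_inj _ C); rewrite sqnE ofR_conj -rmorphM expr2. Qed.

Lemma sqn0 (R : realType) (C : cplx R) : sqn (0 : C) = 0.
Proof. by rewrite -(rmorph0 (ofR C)) sqnR expr0n. Qed.

(** * Adjoints, Hermitian and unitary matrices *)

Lemma tcM (C : numClosedFieldType) m n p (A : 'M[C]_(m, n)) (B : 'M[C]_(n, p)) :
  (A *m B) ^t* = B ^t* *m A ^t*.
Proof. by rewrite trmx_mul map_mxM. Qed.

Lemma tcD (C : numClosedFieldType) m n (A B : 'M[C]_(m, n)) :
  (A + B) ^t* = A ^t* + B ^t*.
Proof. by rewrite linearD /= map_mxD. Qed.

Lemma tcN (C : numClosedFieldType) m n (A : 'M[C]_(m, n)) : (- A) ^t* = - A ^t*.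
Proof. by apply/matrixP => i j; rewrite !mxE rmorphN. Qed.

Lemma tc0 (C : numClosedFieldType) m n : (0 : 'M[C]_(m, n)) ^t* = 0.
Proof. by apply/matrixP => i j; rewrite !mxE rmorph0. Qed.

Lemma tc1 (C : numClosedFieldType) n : (1%:M : 'M[C]_n) ^t* = 1%:M.
Proof. by rewrite trmx1 map_mx1. Qed.

Lemma hermP (C : numClosedFieldType) n (A : 'M[C]_n) :
  (A \is hermsymmx) <-> (A ^t* = A).
Proof.
rewrite qualifE /= expr0 scale1r; split=> [/eqP {2}->//|->]; exact: eqxx.
Qed.

Lemma hermD (C : numClosedFieldType) n (A B : 'M[C]_n) :
  A \is hermsymmx -> B \is hermsymmx -> A + B \is hermsymmx.
Proof. by move=> /hermP a /hermP b; apply/hermP; rewrite tcD a b. Qed.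

Lemma herm_sandwich (C : numClosedFieldType) m n (A : 'M[C]_n)
    (X : 'M[C]_(m, n)) :
  A \is hermsymmx -> X *m A *m X ^t* \is hermsymmx.
Proof. by move=> /hermP a; apply/hermP; rewrite !tcM trmxCK a mulmxA. Qed.

Lemma herm_gram (C : numClosedFieldType) m n (X : 'M[C]_(m, n)) :
  X *m X ^t* \is hermsymmx.
Proof. by apply/hermP; rewrite tcM trmxCK. Qed.

Lemma unitaryC (C : numClosedFieldType) n (U : 'M[C]_n) :
  U \is unitarymx -> U ^t* *m U = 1%:M.
Proof. by move=> Uu; rewrite -invmx_unitary // mulVmx // unitarymx_unit. Qed.

Lemma unitaryR (C : numClosedFieldType) n (U : 'M[C]_n) :
  U \is unitarymx -> U *m U ^t* = 1%:M.
Proof. by move/unitarymxP. Qed.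

Lemma unitary1 (C : numClosedFieldType) n : (1%:M : 'M[C]_n) \is unitarymx.
Proof. by apply/unitarymxP; rewrite mul1mx tc1. Qed.

Lemma unitary_tc (C : numClosedFieldType) n (U : 'M[C]_n) :
  U \is unitarymx -> U ^t* \is unitarymx.
Proof. by rewrite trmxC_unitary. Qed.

(* The eigenvectors of specmx U a are the conjugated rows of U, its eigenvalues
   are the a i. *)
Definition specmx (R : realType) (C : cplx R) n (U : 'M[C]_n) (a : 'I_n -> R) :
    'M[C]_n :=
  U ^t* *m diag_mx (\row_i ofR C (a i)) *m U.

Definition eigval (R : realType) (C : cplx R) n (A : 'M[C]_n) (i : 'I_n) : R :=
  reR (spectral_diag A 0 i).

(** A real sum over the spectrum rather than the trace of a matrix: on Hermitian matrices it depends
    only on the characteristic polynomial ([trfun_char]). The functional calculus returns in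
    [tr_hermfunc]. *)
Definition trfun (R : realType) (C : cplx R) n (f : R -> R) (A : 'M[C]_n) : R :=
  \sum_i f (eigval A i).

Notation trp q A := (trfun (fun x => x `^ q) A).

Lemma tc_diag (R : realType) (C : cplx R) n (a : 'I_n -> R) :
  (diag_mx (\row_i ofR C (a i))) ^t* = diag_mx (\row_i ofR C (a i)).
Proof.
apply/matrixP => i j; rewrite !mxE rmorphMn /= ofR_conj eq_sym.
by case: eqP => [->|].
Qed.

Lemma eq_specmx (R : realType) (C : cplx R) n (U : 'M[C]_n) a b : a =1 b ->
  specmx U a = specmx U b.
Proof.
move=> ab; rewrite /specmx (_ : (\row_i ofR C (a i)) = \row_i ofR C (b i)) //.
by apply/rowP => i; rewrite !mxE ab.
Qed.

Lemma specmx_herm (R : realType) (C : cplx R) n (U : 'M[C]_n) a :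
  specmx U a \is hermsymmx.
Proof. by apply/hermP; rewrite /specmx !tcM tc_diag trmxCK mulmxA. Qed.

Lemma specmx_eigval (R : realType) (C : cplx R) n (A : 'M[C]_n) :
  A \is hermsymmx -> specmx (spectralmx A) (eigval A) = A.
Proof.
move=> Ah; rewrite [RHS](orthomx_spectralP (hermitian_normalmx Ah)).
rewrite invmx_unitary ?spectral_unitarymx // /specmx.
rewrite (_ : \row_i ofR C (eigval A i) = spectral_diag A) //; apply/rowP => i.
by rewrite !mxE reR_real // (mxOverP (hermitian_spectral_diag_real Ah)).
Qed.

Lemma tr_specmx (R : realType) (C : cplx R) n (U : 'M[C]_n) a :
  U \is unitarymx -> \tr (specmx U a) = ofR C (\sum_i a i).
Proof.
move=> Uu; rewrite /specmx -mulmxA mxtrace_mulC -mulmxA unitaryR // mulmx1.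
by rewrite mxtrace_diag rmorph_sum; apply: eq_bigr => i _; rewrite mxE.
Qed.

Lemma specmx_mul (R : realType) (C : cplx R) n (U : 'M[C]_n) a b :
  U \is unitarymx -> specmx U a *m specmx U b = specmx U (fun i => a i * b i).
Proof.
move=> Uu; rewrite /specmx -!mulmxA (mulmxA U (U ^t*)) unitaryR // mul1mx.
rewrite (mulmxA (diag_mx _)) mulmx_diag.
congr (_ *m (diag_mx _ *m _)); apply/rowP => i.
by rewrite !mxE rmorphM.
Qed.

Lemma specmx1 (R : realType) (C : cplx R) n (U : 'M[C]_n) :
  U \is unitarymx -> specmx U (fun=> 1) = 1%:M.
Proof.
move=> Uu; rewrite /specmx (_ : diag_mx _ = 1%:M) ?mulmx1 ?unitaryC //.
by apply/matrixP => i j; rewrite !mxE rmorph1.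
Qed.

Lemma specmx_conj (R : realType) (C : cplx R) n (U V : 'M[C]_n) a :
  V *m specmx U a *m V ^t* = specmx (U *m V ^t*) a.
Proof. by rewrite /specmx tcM trmxCK !mulmxA. Qed.

(** * Spectral traces and characteristic polynomials *)

(** Eliminating one block of [M] on the right shows that its determinant is the left side;
    eliminating on the left gives the right side, with a factor 'X^n on both sides that cancels in
    the domain of polynomials. *)
Lemma char_poly_mulC (F : fieldType) n (X Y : 'M[F]_n) :
  char_poly (X *m Y) = char_poly (Y *m X).
Proof.
pose m (A : 'M[F]_n) : 'M[{poly F}]_n := map_mx polyC A.
pose M := block_mx ('X%:M) (m X) (m Y) 1%:M.
have e1 : M *m block_mx 1%:M 0 (- m Y) 1%:M =
    block_mx ('X%:M - m (X *m Y)) (m X) 0 1%:M.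
  rewrite mulmx_block !mulmx1 !mulmx0 !mul1mx addrN !add0r mulmxN.
  by rewrite /m map_mxM.
have e2 : block_mx 1%:M 0 (- m Y) ('X%:M) *m M =
    block_mx ('X%:M) (m X) 0 ('X%:M - m (Y *m X)).
  rewrite mulmx_block !mul1mx !mul0mx !addr0 mulmx1 !mulNmx /m map_mxM.
  by rewrite scalar_mxC addNr addrC.
have d1 := congr1 determinant e1; have d2 := congr1 determinant e2.
rewrite det_mulmx det_lblock det_ublock !det1 !mulr1 in d1.
rewrite det_mulmx det_lblock det_ublock !det1 mul1r d1 in d2.
apply: (@mulfI _ (\det ('X%:M : 'M[{poly F}]_n))).
  by rewrite det_scalar expf_neq0 // polyX_eq0.
exact: d2.
Qed.

Lemma char_poly_specmx (R : realType) (C : cplx R) n (U : 'M[C]_n) a :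
  U \is unitarymx -> char_poly (specmx U a) = \prod_i ('X - (ofR C (a i))%:P).
Proof.
move=> Uu; rewrite /specmx -mulmxA char_poly_mulC -mulmxA unitaryR // mulmx1.
rewrite char_poly_trig; last exact/diag_mx_is_trig.
by apply: eq_bigr => i _; rewrite !mxE eqxx.
Qed.

Lemma eigval_unique (R : realType) (C : cplx R) n (A : 'M[C]_n) (b : 'I_n -> R) :
  A \is hermsymmx -> char_poly A = \prod_i ('X - (ofR C (b i))%:P) ->
  perm_eq [seq eigval A i | i : 'I_n] [seq b i | i : 'I_n].
Proof.
move=> Ah; rewrite -{1}(specmx_eigval Ah) char_poly_specmx ?spectral_unitarymx //.
move=> h; apply: (@perm_map_inj _ _ (ofR C) (@ofR_inj _ C)); rewrite -!map_comp.
by apply: prod_XsubC_eq; rewrite !big_map h.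
Qed.

Lemma trfun_eig (R : realType) (C : cplx R) n (A : 'M[C]_n) f (b : 'I_n -> R) :
  A \is hermsymmx -> char_poly A = \prod_i ('X - (ofR C (b i))%:P) ->
  trfun f A = \sum_i f (b i).
Proof.
move=> Ah h; rewrite /trfun.
transitivity (\sum_(x <- [seq eigval A i | i : 'I_n]) f x).
  by rewrite big_image.
by rewrite (perm_big _ (eigval_unique Ah h)) big_image.
Qed.

Lemma trfun_specmx (R : realType) (C : cplx R) n f (U : 'M[C]_n) a :
  U \is unitarymx -> trfun f (specmx U a) = \sum_i f (a i).
Proof.
move=> Uu; apply: trfun_eig (specmx_herm U a) _; exact: char_poly_specmx.
Qed.

Lemma trfun_char (R : realType) (C : cplx R) n f (A B : 'M[C]_n) :
  A \is hermsymmx -> B \is hermsymmx -> char_poly A = char_poly B ->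
  trfun f A = trfun f B.
Proof.
move=> Ah Bh h; apply: trfun_eig => //.
by rewrite h -{1}(specmx_eigval Bh) char_poly_specmx // spectral_unitarymx.
Qed.

Lemma trfun_gramC (R : realType) (C : cplx R) n f (X : 'M[C]_n) :
  trfun f (X ^t* *m X) = trfun f (X *m X ^t*).
Proof.
apply: trfun_char; [|exact: herm_gram|exact: char_poly_mulC].
by rewrite -{2}[X]trmxCK herm_gram.
Qed.

(** * Tangent-line inequalities for real powers *)

Lemma powRDge (R : realType) (x s t : R) : 0 <= s -> 0 <= t ->
  x `^ (s + t) = x `^ s * x `^ t.
Proof.
move=> s0 t0; have [/eqP|st] := eqVneq (s + t) 0.
  by rewrite paddr_eq0 // => /andP[/eqP-> /eqP->]; rewrite addr0 powRr0 mulr1.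
by rewrite powRD // (negbTE st).
Qed.

(** For positive x and y, both lie above the tangent of exp at the weighted mean [z] of their
    logarithms, and the first-order terms cancel in the weighted sum. *)
Lemma young_powR (R : realType) (x y h : R) : 0 <= x -> 0 <= y ->
  0 <= h -> h <= 1 -> x `^ h * y `^ (1 - h) <= h * x + (1 - h) * y.
Proof.
rewrite le_eqVlt => /predU1P[<-|x0].
  move=> y0 h0 h1; have [->|hn] := eqVneq h 0.
    by rewrite powRr0 subr0 powRr1 // mul0r add0r !mul1r.
  by rewrite powR0 // mul0r mulr0 add0r mulr_ge0 // subr_ge0.
rewrite le_eqVlt => /predU1P[<-|y0] h0 h1.
  have [->|hn] := eqVneq h 1.
    by rewrite subrr powRr0 (powRr1 (ltW x0)) mul0r addr0 mulr1 mul1r.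
  by rewrite powR0 ?subr_eq0 1?eq_sym // !mulr0 addr0 mulr_ge0 // ltW.
have -> : x `^ h * y `^ (1 - h) = expR (h * ln x + (1 - h) * ln y).
  by rewrite /powR !gt_eqF // expRD.
set z := h * ln x + (1 - h) * ln y.
have ex t : 0 < t -> expR z * (1 + (ln t - z)) <= t.
  move=> t0; rewrite -[leRHS](lnK t0).
  have -> : expR (ln t) = expR z * expR (ln t - z) by rewrite -expRD addrC subrK.
  by rewrite ler_wpM2l ?expR_ge0 ?expR_ge1Dx.
have := ler_wpM2l h0 (ex _ x0).
have := ler_wpM2l (_ : 0 <= 1 - h) (ex _ y0); rewrite subr_ge0 => /(_ h1) a b.
apply: le_trans (lerD b a); rewrite le_eqVlt; apply/orP; left; apply/eqP.
by rewrite /z; ring.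
Qed.

(** Young with weight 1/p on x^p and y^p bounds x y^(p-1). No derivative is taken, so zero arguments
    are allowed. *)
Lemma powR_tangent_ge1 (R : realType) (p x y : R) : 1 <= p -> 0 <= x -> 0 <= y ->
  y `^ p + p * y `^ (p - 1) * (x - y) <= x `^ p.
Proof.
move=> p1 x0 y0; have p0 : 0 < p by rewrite (lt_le_trans ltr01).
have pn : p != 0 by rewrite gt_eqF.
have h1 : p^-1 <= 1 by rewrite invf_le1.
have := young_powR (powR_ge0 x p) (powR_ge0 y p) (ltW (_ : 0 < p^-1)) h1.
rewrite invr_gt0 => /(_ p0); rewrite -!powRrM mulfV // powRr1 //.
rewrite mulrBr mulr1 mulfV // => h.
have e : y `^ (p - 1) * y = y `^ p by rewrite mulrC mulr_powRB1.
have := ler_wpM2l (ltW p0) h.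
rewrite mulrDr !mulrA mulfV // mul1r mulrBr mulfV // mulr1 => {}h.
rewrite mulrBr -!mulrA e mulrA; move: h; rewrite !(mulrAC p x) -!mulrA; lra.
Qed.

(** Young with weight 1/(1-q) on x^q and y^(q-1) x: the powers of x cancel in the product and leave
    y^q. *)
Lemma powR_tangent_lt0 (R : realType) (q x y : R) : q < 0 -> 0 < x -> 0 < y ->
  y `^ q + q * y `^ (q - 1) * (x - y) <= x `^ q.
Proof.
move=> q0 x0 y0; have r0 : 0 < 1 - q by lra.
have rn : 1 - q != 0 by rewrite gt_eqF.
have h1 : (1 - q)^-1 <= 1 by rewrite invf_le1 //; lra.
have h0 : 0 <= (1 - q)^-1 by rewrite invr_ge0 ltW.
have z0 : 0 <= y `^ (q - 1) * x by rewrite mulr_ge0 ?powR_ge0 // ltW.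
have := young_powR (powR_ge0 x q) z0 h0 h1.
rewrite (powRM _ (powR_ge0 _ _) (ltW x0)) -!powRrM mulrCA -powRD; last first.
  by rewrite (gt_eqF x0) implybT.
have -> : q / (1 - q) + (1 - (1 - q)^-1) = 0 by field.
have -> : (q - 1) * (1 - (1 - q)^-1) = q by field.
rewrite powRr0 mulr1 => h.
have := ler_wpM2l (ltW r0) h.
have -> : (1 - q) * ((1 - q)^-1 * x `^ q + (1 - (1 - q)^-1) * (y `^ (q - 1) * x))
  = x `^ q - q * (y `^ (q - 1) * x) by field.
have e : y `^ (q - 1) * y = y `^ q.
  by rewrite -{2}(powRr1 (ltW y0)) -powRD ?subrK // (gt_eqF y0) implybT.
rewrite mulrBr -!mulrA e; lra.
Qed.

Lemma normR_tangent (R : realType) (s x y : R) : 1 <= s ->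
  `|y| `^ s + s * (Num.sg y * `|y| `^ (s - 1)) * (x - y) <= `|x| `^ s.
Proof.
move=> s1; have s0 : 0 <= s by lra.
apply: le_trans (powR_tangent_ge1 s1 (normr_ge0 x) (normr_ge0 y)).
have sg1 : `|Num.sg y| <= 1.
  by rewrite normr_sg; case: (y != 0); [exact: lexx | exact: ler01].
have h : Num.sg y * (x - y) <= `|x| - `|y|.
  rewrite mulrBr -normrEsg lerB // (le_trans (ler_norm _)) // normrM.
  by rewrite ler_piMl.
rewrite lerD2l (mulrC (Num.sg y)) mulrA -mulrA ler_wpM2l // mulr_ge0 //.
exact: powR_ge0.
Qed.

(** * Diagonal entries in an orthonormal basis *)

Lemma unitary_col (R : realType) (C : cplx R) n (W : 'M[C]_n) k :
  W \is unitarymx -> \sum_i sqn (W i k) = 1.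
Proof.
move=> Wu; apply: (@ofR_inj _ C); rewrite rmorph_sum rmorph1.
have /matrixP/(_ k k) := unitaryC Wu; rewrite !mxE eqxx mulr1n => <-.
by apply: eq_bigr => i _; rewrite !mxE sqnE.
Qed.

Lemma unitary_row (R : realType) (C : cplx R) n (W : 'M[C]_n) i :
  W \is unitarymx -> \sum_k sqn (W i k) = 1.
Proof.
move=> Wu; rewrite -(unitary_col i (unitary_tc Wu)).
by apply: eq_bigr => k _; rewrite !mxE sqn_conj.
Qed.

Lemma specmx_entry (R : realType) (C : cplx R) n (W : 'M[C]_n) a j k :
  specmx W a j k = \sum_i conjC (W i j) * ofR C (a i) * W i k.
Proof.
rewrite /specmx mul_mx_diag !mxE; apply: eq_bigr => i _; by rewrite !mxE.
Qed.

(* The k-th diagonal entry of A in the basis given by the rows of V. *)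
Definition dgl (R : realType) (C : cplx R) n (V A : 'M[C]_n) (k : 'I_n) : R :=
  reR ((V *m A *m V ^t*) k k).

Lemma dglE (R : realType) (C : cplx R) n (V U : 'M[C]_n) a k :
  dgl V (specmx U a) k = \sum_i sqn ((U *m V ^t*) i k) * a i.
Proof.
rewrite /dgl specmx_conj specmx_entry reR_sum; apply: eq_bigr => i _.
by rewrite mulrAC -sqnE -rmorphM ofRK.
Qed.

Lemma dglD (R : realType) (C : cplx R) n (V A B : 'M[C]_n) k :
  dgl V (A + B) k = dgl V A k + dgl V B k.
Proof. by rewrite /dgl mulmxDr mulmxDl mxE reRD. Qed.

Lemma dgl_eig (R : realType) (C : cplx R) n (V : 'M[C]_n) a k :
  V \is unitarymx -> dgl V (specmx V a) k = a k.
Proof.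
move=> Vu; rewrite dglE unitaryR // (bigD1 k) //= mxE eqxx big1 => [|i ik].
  by rewrite -(rmorph1 (ofR C)) sqnR expr1n mul1r addr0.
by rewrite mxE (negbTE ik) sqn0 mul0r.
Qed.

Lemma dgl_ofR (R : realType) (C : cplx R) n (V A : 'M[C]_n) k : A \is hermsymmx ->
  ofR C (dgl V A k) = (V *m A *m V ^t*) k k.
Proof.
move=> Ah; apply: reR_real; apply/CrealP.
by have /hermP/matrixP/(_ k k) := herm_sandwich V Ah; rewrite !mxE.
Qed.

Lemma dgl_herm (R : realType) (C : cplx R) n (V A : 'M[C]_n) k : A \is hermsymmx ->
  dgl V A k = \sum_i sqn ((spectralmx A *m V ^t*) i k) * eigval A i.
Proof. by move=> Ah; rewrite -{1}(specmx_eigval Ah) dglE. Qed.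

Lemma unitaryM_tc (R : realType) (C : cplx R) n (U V : 'M[C]_n) :
  U \is unitarymx -> V \is unitarymx -> U *m V ^t* \is unitarymx.
Proof. by move=> Uu Vu; apply: mul_unitarymx => //; apply: unitary_tc. Qed.

(** * Diagonal entries and convexity *)

(** The weights [sqn (W i k)] are doubly stochastic: column sums make each diagonal entry an average
    of eigenvalues, row sums recover the trace. Convexity enters only as a supporting line tested on
    the eigenvalues, so [f] may be convex on a half-line only. *)
Lemma peierls (R : realType) (C : cplx R) n (A V : 'M[C]_n) (f : R -> R) :
  A \is hermsymmx -> V \is unitarymx ->
  (forall k, exists c, forall i,
     f (dgl V A k) + c * (eigval A i - dgl V A k) <= f (eigval A i)) ->
  \sum_k f (dgl V A k) <= trfun f A.
Proof.
move=> Ah Vu H; set W := spectralmx A *m V ^t*.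
have Wu : W \is unitarymx by rewrite unitaryM_tc ?spectral_unitarymx.
have -> : trfun f A = \sum_k \sum_i sqn (W i k) * f (eigval A i).
  rewrite exchange_big /=; apply: eq_bigr => i _.
  by rewrite -mulr_suml unitary_row // mul1r.
apply: ler_sum => k _; have [c hc] := H k.
apply: le_trans (ler_sum _ (fun i _ => ler_wpM2l (sqn_ge0 (W i k)) (hc i))).
under eq_bigr do rewrite mulrDr mulrCA mulrBr.
rewrite big_split /= -mulr_suml unitary_col // mul1r -mulr_sumr sumrB.
by rewrite -mulr_suml unitary_col // mul1r -dgl_herm // subrr mulr0 addr0.
Qed.

Definition psd (R : realType) (C : cplx R) n (A : 'M[C]_n) : Prop :=
  A \is hermsymmx /\ forall i, 0 <= eigval A i.

Definition hpow (R : realType) (C : cplx R) n (A : 'M[C]_n) (s : R) : 'M[C]_n :=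
  specmx (spectralmx A) (fun i => eigval A i `^ s).

Lemma dgl_eigval (R : realType) (C : cplx R) n (A : 'M[C]_n) k :
  A \is hermsymmx -> dgl (spectralmx A) A k = eigval A k.
Proof.
by move=> Ah; rewrite -{2}(specmx_eigval Ah) dgl_eig ?spectral_unitarymx.
Qed.

Lemma dgl_ge0 (R : realType) (C : cplx R) n (A V : 'M[C]_n) k :
  psd A -> 0 <= dgl V A k.
Proof.
by case=> Ah A0; rewrite dgl_herm // sumr_ge0 // => i _; rewrite mulr_ge0 ?sqn_ge0.
Qed.

Lemma psd_dgl (R : realType) (C : cplx R) n (A : 'M[C]_n) : A \is hermsymmx ->
  (forall V k, V \is unitarymx -> 0 <= dgl V A k) -> psd A.
Proof.
move=> Ah H; split=> // i; rewrite -dgl_eigval //; apply: H.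
exact: spectral_unitarymx.
Qed.

Lemma dgl_gram (R : realType) (C : cplx R) m n (V : 'M[C]_n) (X : 'M[C]_(n, m)) k :
  dgl V (X *m X ^t*) k = \sum_j sqn ((V *m X) k j).
Proof.
rewrite /dgl mulmxA -mulmxA -tcM mxE reR_sum; apply: eq_bigr => j _.
by rewrite !mxE mulrC -sqnE ofRK.
Qed.

Lemma psd_gram (R : realType) (C : cplx R) m n (X : 'M[C]_(n, m)) :
  psd (X *m X ^t*).
Proof.
apply: psd_dgl => [|V k _]; first exact: herm_gram.
by rewrite dgl_gram sumr_ge0 // => j _; apply: sqn_ge0.
Qed.

Lemma psdD (R : realType) (C : cplx R) n (A B : 'M[C]_n) :
  psd A -> psd B -> psd (A + B).
Proof.
move=> pA pB; apply: psd_dgl => [|V k _].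
  by apply: hermD; [case: pA | case: pB].
by rewrite dglD addr_ge0 ?dgl_ge0.
Qed.

Lemma psd_specmx (R : realType) (C : cplx R) n (U : 'M[C]_n) a :
  (forall i, 0 <= a i) -> psd (specmx U a).
Proof.
move=> a0; apply: psd_dgl => [|V k _]; first exact: specmx_herm.
by rewrite dglE sumr_ge0 // => j _; rewrite mulr_ge0 ?sqn_ge0.
Qed.

Lemma hpow_herm (R : realType) (C : cplx R) n (A : 'M[C]_n) s :
  hpow A s \is hermsymmx.
Proof. exact: specmx_herm. Qed.

Lemma hpow_tc (R : realType) (C : cplx R) n (A : 'M[C]_n) s :
  (hpow A s) ^t* = hpow A s.
Proof. exact/hermP/hpow_herm. Qed.

Lemma hpow1 (R : realType) (C : cplx R) n (A : 'M[C]_n) : psd A -> hpow A 1 = A.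
Proof.
case=> Ah A0; rewrite -[RHS](specmx_eigval Ah).
by apply: eq_specmx => i; rewrite powRr1.
Qed.

Lemma hpowD (R : realType) (C : cplx R) n (A : 'M[C]_n) s t : 0 <= s -> 0 <= t ->
  hpow A s *m hpow A t = hpow A (s + t).
Proof.
move=> s0 t0; rewrite specmx_mul ?spectral_unitarymx //.
by apply: eq_specmx => i; rewrite powRDge.
Qed.

Lemma hpow_half (R : realType) (C : cplx R) n (A : 'M[C]_n) s : 0 <= s ->
  hpow A (s / 2) *m hpow A (s / 2) = hpow A s.
Proof. by move=> s0; rewrite hpowD ?divr_ge0 // -splitr. Qed.

Lemma trfun_ge0 (R : realType) (C : cplx R) n (A : 'M[C]_n) f :
  (forall x, 0 <= f x) -> 0 <= trfun f A.
Proof. by move=> f0; apply: sumr_ge0. Qed.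

Lemma peierls_ge1 (R : realType) (C : cplx R) n (A V : 'M[C]_n) p :
  psd A -> V \is unitarymx -> 1 <= p -> \sum_k dgl V A k `^ p <= trp p A.
Proof.
move=> pA Vu p1; apply: (@peierls _ _ _ _ _ (fun x => x `^ p)) => //.
  by case: pA.
move=> k; exists (p * dgl V A k `^ (p - 1)) => i.
by apply: powR_tangent_ge1 => //; [case: pA | exact: dgl_ge0].
Qed.

Lemma peierls_norm (R : realType) (C : cplx R) n (A V : 'M[C]_n) s :
  A \is hermsymmx -> V \is unitarymx -> 1 <= s ->
  \sum_k `|dgl V A k| `^ s <= trfun (fun x => `|x| `^ s) A.
Proof.
move=> Ah Vu s1; apply: (@peierls _ _ _ _ _ (fun x => `|x| `^ s)) => // k.
exists (s * (Num.sg (dgl V A k) * `|dgl V A k| `^ (s - 1))) => i.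
exact: normR_tangent.
Qed.

Lemma dgl_gt0 (R : realType) (C : cplx R) n (A V : 'M[C]_n) k :
  A \is hermsymmx -> (forall i, 0 < eigval A i) -> V \is unitarymx ->
  0 < dgl V A k.
Proof.
move=> Ah A0 Vu; rewrite lt_neqAle dgl_ge0 ?andbT; last by split=> // i; rewrite ltW.
apply/negP => /eqP /esym; rewrite dgl_herm // => /eqP.
set W := spectralmx A *m V ^t*.
have Wu : W \is unitarymx by rewrite unitaryM_tc ?spectral_unitarymx.
rewrite psumr_eq0 => [/allP h|i _]; last by rewrite mulr_ge0 ?sqn_ge0 // ltW.
have := unitary_col k Wu; rewrite big1 => [/eqP|i _]; first by rewrite eq_sym oner_eq0.
have := h i (mem_index_enum _); rewrite /= mulf_eq0 (gt_eqF (A0 i)) orbF.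
by move/eqP.
Qed.

Lemma peierls_lt0 (R : realType) (C : cplx R) n (A V : 'M[C]_n) q :
  A \is hermsymmx -> (forall i, 0 < eigval A i) -> V \is unitarymx -> q < 0 ->
  \sum_k dgl V A k `^ q <= trp q A.
Proof.
move=> Ah A0 Vu q0; apply: (@peierls _ _ _ _ _ (fun x => x `^ q)) => // k.
exists (q * dgl V A k `^ (q - 1)) => i.
by apply: powR_tangent_lt0 => //; apply: dgl_gt0.
Qed.

(** * A Taylor inequality for weighted sums of powers *)

Lemma ge0_derive01 (R : realType) (F dF : R -> R) :
  (forall t : R, 0 <= t <= 1 -> is_derive t 1 F (dF t)) ->
  (forall t : R, 0 <= t <= 1 -> 0 <= dF t) ->
  forall t : R, 0 <= t <= 1 -> F 0 <= F t.
Proof.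
move=> hF dF0 t /andP[t0 t1].
have [||c c0t h] := @MVT_segment R F dF 0 t t0.
- move=> x; rewrite in_itv /= => /andP[x0 xt]; apply: hF.
  by rewrite (ltW x0) (ltW (lt_le_trans xt t1)).
- apply: derivable_within_continuous => x; rewrite in_itv /= => /andP[x0 xt].
  by apply: ex_derive; apply: hF; rewrite x0 (le_trans xt t1).
move: c0t; rewrite in_itv /= => /andP[c0 ct].
rewrite -subr_ge0 h subr0 mulr_ge0 // dF0 // c0 //=; exact: le_trans ct t1.
Qed.

Lemma is_derive_scale (R : realType) (k : R) (f : R -> R) (t df : R) :
  is_derive t 1 f df -> is_derive t 1 (fun t => k * f t) (k * df).
Proof. by move=> H; apply: (@is_deriveZ _ _ _ f k). Qed.

Lemma is_derive_addf (R : realType) (f g : R -> R) (t df dg : R) :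
  is_derive t 1 f df -> is_derive t 1 g dg ->
  is_derive t 1 (fun t => f t + g t) (df + dg).
Proof. by move=> H K; apply: (@is_deriveD _ _ _ f g). Qed.

Lemma is_derive_sumf (R : realType) (I : finType) (h : I -> R -> R)
    (dh : I -> R) (t : R) :
  (forall i, is_derive t 1 (h i) (dh i)) ->
  is_derive t 1 (fun t => \sum_i h i t) (\sum_i dh i).
Proof.
move=> H; have -> : (fun t => \sum_i h i t) = \sum_i h i.
  by apply/funext => s; rewrite fct_sumE.
elim/big_ind2 : _ => [|f df g dg ? ?|i _]; last exact: H.
  exact: is_derive_cst.
exact: is_deriveD.
Qed.

Lemma is_derive_affine (R : realType) (x y t : R) :
  is_derive t 1 (fun t : R => x + t * y) y.
Proof.
have -> : (fun t : R => x + t * y) = (fun t => x + y * t).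
  by apply/funext => s; rewrite mulrC.
have := is_derive_addf (is_derive_cst x t 1) (is_derive_scale y (is_derive_id t 1)).
by rewrite add0r mulr1.
Qed.

Lemma is_derive_powR_affine (R : realType) (q x y t : R) : 0 < x + t * y ->
  is_derive t 1 (fun t => (x + t * y) `^ q) (q * y * (x + t * y) `^ (q - 1)).
Proof.
move=> h; rewrite (mulrAC q).
exact: (@is_derive1_comp _ (@powR R ^~ q) (fun t => x + t * y) t _ _
  (is_derive1_powR q h) (is_derive_affine x y t)).
Qed.

(** The weights [c] may be negative, so the terms cannot be treated one by one: the hypothesis
    concerns the whole second derivative along the segment, and is integrated twice. *)
Lemma taylor_powR_sum (R : realType) (I : finType) (c x y : I -> R) (q : R) :
  2 <= q -> (forall i, 0 < x i) -> (forall i, 0 < x i + y i) ->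
  (forall t : R, 0 <= t <= 1 ->
     0 <= \sum_i c i * y i ^+ 2 * (x i + t * y i) `^ (q - 2)) ->
  0 <= \sum_i c i * ((x i + y i) `^ q - x i `^ q - q * x i `^ (q - 1) * y i).
Proof.
move=> q2 x0 xy0 H.
have pos i : forall t : R, 0 <= t <= 1 -> 0 < x i + t * y i.
  move=> t /andP[t0 t1].
  have -> : x i + t * y i = (1 - t) * x i + t * (x i + y i) by ring.
  have [->|tn] := eqVneq t 1; first by rewrite subrr mul0r add0r mul1r.
  apply: ltr_wpDr; first by rewrite mulr_ge0 // ltW.
  by rewrite mulr_gt0 // subr_gt0 lt_neqAle tn.
(* The linear term is subtracted inside [F], so that its derivative [G] vanishes at 0 and F 1 - F 0
   is the sum to be bounded. *)
pose F t := \sum_i (c i * (x i + t * y i) `^ q +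
   (0 + t * - (c i * (q * x i `^ (q - 1) * y i)))).
pose G t := \sum_i (c i * (q * y i * (x i + t * y i) `^ (q - 1)) +
   - (c i * (q * x i `^ (q - 1) * y i))).
pose K t := \sum_i (c i * (q * y i *
   ((q - 1) * y i * (x i + t * y i) `^ (q - 1 - 1))) + 0).
have dF : forall t : R, 0 <= t <= 1 -> is_derive t 1 F (G t).
  move=> t ht; rewrite /F /G; apply: is_derive_sumf => i; apply: is_derive_addf.
    exact/is_derive_scale/is_derive_powR_affine/pos.
  exact: is_derive_affine.
have dG : forall t : R, 0 <= t <= 1 -> is_derive t 1 G (K t).
  move=> t ht; rewrite /G /K; apply: is_derive_sumf => i; apply: is_derive_addf.
  exact/is_derive_scale/is_derive_scale/is_derive_powR_affine/pos.
have K0 : forall t : R, 0 <= t <= 1 -> 0 <= K t.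
  move=> t ht; have qq : 0 <= q * (q - 1) by apply: mulr_ge0; lra.
  have := mulr_ge0 qq (H t ht); rewrite mulr_sumr.
  congr (_ <= _); apply: eq_bigr => i _.
  by rewrite (_ : q - 1 - 1 = q - 2); ring.
have G0 : forall t : R, 0 <= t <= 1 -> 0 <= G t.
  move=> t ht; have := ge0_derive01 dG K0 ht; congr (_ <= _).
  by rewrite /G big1 // => i _; rewrite mul0r addr0; ring.
have := ge0_derive01 dF G0 (_ : 0 <= (1 : R) <= 1); rewrite lexx ler01 => /(_ isT).
rewrite -subr_ge0 -sumrB; congr (_ <= _); apply: eq_bigr => i _.
by rewrite !mul0r !mul1r !add0r !addr0; ring.
Qed.

(** * Operator Jensen inequalities for powers *)

Definition dm (R : realType) (C : cplx R) n (a : 'I_n -> R) : 'M[C]_n :=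
  diag_mx (\row_i ofR C (a i)).

(** The quadratic form of [dm a] as a real sum; operator inequalities are stated as inequalities of
    [wnorm] at every vector. *)
Definition wnorm (R : realType) (C : cplx R) n (a : 'I_n -> R) (v : 'cV[C]_n) : R :=
  \sum_i sqn (v i 0) * a i.

Lemma dmE (R : realType) (C : cplx R) n (a : 'I_n -> R) (v : 'cV[C]_n) i :
  (dm C a *m v) i 0 = ofR C (a i) * v i 0.
Proof. by rewrite /dm mul_diag_mx !mxE. Qed.

Lemma dm_mul (R : realType) (C : cplx R) n (a b : 'I_n -> R) :
  dm C a *m dm C b = dm C (fun i => a i * b i).
Proof.
rewrite /dm mulmx_diag; congr diag_mx; apply/rowP => i.
by rewrite !mxE rmorphM.
Qed.

Lemma eq_dm (R : realType) (C : cplx R) n (a b : 'I_n -> R) : a =1 b ->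
  dm C a = dm C b.
Proof. by move=> ab; congr diag_mx; apply/rowP => i; rewrite !mxE ab. Qed.

Lemma dm1 (R : realType) (C : cplx R) n : dm C (fun _ : 'I_n => 1) = 1%:M.
Proof. by apply/matrixP => i j; rewrite !mxE rmorph1. Qed.

Lemma tc_dm (R : realType) (C : cplx R) n (a : 'I_n -> R) : (dm C a) ^t* = dm C a.
Proof. exact: tc_diag. Qed.

Lemma wnormE (R : realType) (C : cplx R) n (a : 'I_n -> R) (v : 'cV[C]_n) :
  ofR C (wnorm a v) = (v ^t* *m dm C a *m v) 0 0.
Proof.
rewrite -mulmxA mxE rmorph_sum; apply: eq_bigr => i _.
by rewrite dmE rmorphM sqnE !mxE mulrCA mulrC mulrA.
Qed.

Lemma wnorm_dm (R : realType) (C : cplx R) n (a b : 'I_n -> R) (v : 'cV[C]_n) :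
  wnorm a (dm C b *m v) = wnorm (fun i => b i ^+ 2 * a i) v.
Proof.
by apply: eq_bigr => i _; rewrite dmE sqnM sqnR mulrA (mulrC (sqn _)).
Qed.

Lemma eq_wnorm (R : realType) (C : cplx R) n (a b : 'I_n -> R) (v : 'cV[C]_n) :
  a =1 b -> wnorm a v = wnorm b v.
Proof. by move=> ab; apply: eq_bigr => i _; rewrite ab. Qed.

Lemma wnorm_ge0 (R : realType) (C : cplx R) n (a : 'I_n -> R) (v : 'cV[C]_n) :
  (forall i, 0 <= a i) -> 0 <= wnorm a v.
Proof. by move=> a0; apply: sumr_ge0 => i _; rewrite mulr_ge0 ?sqn_ge0. Qed.

Lemma le_wnorm (R : realType) (C : cplx R) n (a b : 'I_n -> R) (v : 'cV[C]_n) :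
  (forall i, a i <= b i) -> wnorm a v <= wnorm b v.
Proof. by move=> ab; apply: ler_sum => i _; rewrite ler_wpM2l ?sqn_ge0. Qed.

Lemma wnormZ (R : realType) (C : cplx R) n (a : 'I_n -> R) (v : 'cV[C]_n) k :
  wnorm (fun i => k * a i) v = k * wnorm a v.
Proof. by rewrite /wnorm mulr_sumr; apply: eq_bigr => i _; rewrite mulrCA. Qed.

Lemma wnorm_isom (R : realType) (C : cplx R) m n (V : 'M[C]_(m, n)) v :
  V ^t* *m V = 1%:M -> wnorm (fun=> 1) (V *m v) = wnorm (fun=> 1) v.
Proof.
move=> Vi; apply: (@ofR_inj _ C); rewrite !wnormE !dm1 !mulmx1 tcM.
by rewrite mulmxA -(mulmxA _ _ V) Vi mulmx1.
Qed.

Lemma wnorm_specmx (R : realType) (C : cplx R) n (U : 'M[C]_n) a v :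
  ofR C (wnorm a (U *m v)) = (v ^t* *m specmx U a *m v) 0 0.
Proof. by rewrite wnormE tcM /specmx !mulmxA. Qed.

Lemma sqn_sub (R : realType) (C : cplx R) (z w : C) t :
  sqn (z - ofR C t * w) = sqn z - 2 * t * reR (conjC z * w) + t ^+ 2 * sqn w.
Proof.
have e (u : C) : sqn u = reR (conjC u * u) by rewrite -sqnE ofRK.
rewrite [LHS]e.
have -> : conjC (z - ofR C t * w) * (z - ofR C t * w) = conjC z * z
   + ofR C (- t) * (conjC z * w) + ofR C (- t) * conjC (conjC z * w)
   + ofR C (t ^+ 2) * (conjC w * w) :> C.
  rewrite rmorphB !rmorphM /= !ofR_conj conjCK rmorphN /=; ring.
rewrite !reRD !reRM reR_conj -!e; ring.
Qed.

Lemma cauchy_schwarz (R : realType) (C : cplx R) n (v w : 'cV[C]_n) :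
  reR ((v ^t* *m w) 0 0) ^+ 2 <= wnorm (fun=> 1) v * wnorm (fun=> 1) w.
Proof.
set a := wnorm _ v; set c := wnorm _ w; set b := reR _.
have eb : b = \sum_i reR (conjC (v i 0) * w i 0).
  by rewrite /b mxE reR_sum; apply: eq_bigr => i _; rewrite !mxE.
have q t : 0 <= a - 2 * t * b + t ^+ 2 * c.
  have -> : a - 2 * t * b + t ^+ 2 * c = \sum_i sqn (v i 0 - ofR C t * w i 0).
    rewrite /a /c eb /wnorm !mulr_sumr -sumrB -big_split /=.
    by apply: eq_bigr => i _; rewrite sqn_sub !mulr1.
  by apply: sumr_ge0 => i _; apply: sqn_ge0.
have c0 : 0 <= c by apply: wnorm_ge0 => i; apply: ler01.
have [cz|cn] := eqVneq c 0.
  rewrite cz mulr0; have [->|bn] := eqVneq b 0; first by rewrite expr0n.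
  (* For c = 0 the polynomial in t is affine with slope - 2 b; at this t its value is -1. *)
  have := q ((a + 1) / (2 * b)); rewrite cz mulr0 addr0.
  have -> : a - 2 * ((a + 1) / (2 * b)) * b = - 1 by field.
  by rewrite oppr_ge0 leNgt ltr01.
have := mulr_ge0 c0 (q (b / c)).
have -> : c * (a - 2 * (b / c) * b + (b / c) ^+ 2 * c) = a * c - b ^+ 2 by field.
by rewrite subr_ge0.
Qed.

Lemma cauchy_schwarz_dm (R : realType) (C : cplx R) n (a b : 'I_n -> R)
    (v w : 'cV[C]_n) :
  reR ((v ^t* *m dm C (fun i => a i * b i) *m w) 0 0) ^+ 2 <=
  wnorm (fun i => a i ^+ 2) v * wnorm (fun i => b i ^+ 2) w.
Proof.
have := cauchy_schwarz (dm C a *m v) (dm C b *m w).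
rewrite !wnorm_dm tcM tc_dm mulmxA -(mulmxA _ (dm C a)) dm_mul.
by congr (_ <= _ * _); apply: eq_wnorm => i; rewrite mulr1.
Qed.

Lemma powR_half_sqr (R : realType) (x s : R) : 0 < x -> (x `^ (s / 2)) ^+ 2 = x `^ s.
Proof.
by move=> x0; rewrite expr2 -powRD -?splitr // (gt_eqF x0) implybT.
Qed.

(* Interpolates Hansen's inequality V^* x^h V <= M y^h between the exponents h - a
   and h + a: Cauchy-Schwarz on the eigenvectors of y^(-h/2) V^* x^h V y^(-h/2). *)
Lemma isom_powR_step (R : realType) (C : cplx R) m n (V : 'M[C]_(m, n))
    (x : 'I_m -> R) (y : 'I_n -> R) h a M1 M2 :
  (forall i, 0 < x i) -> (forall k, 0 < y k) -> 0 <= M1 -> 0 <= M2 ->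
  (forall o, wnorm (fun i => x i `^ (h - a)) (V *m o) <=
     M1 * wnorm (fun k => y k `^ (h - a)) o) ->
  (forall o, wnorm (fun i => x i `^ (h + a)) (V *m o) <=
     M2 * wnorm (fun k => y k `^ (h + a)) o) ->
  forall o, wnorm (fun i => x i `^ h) (V *m o) <=
     Num.sqrt (M1 * M2) * wnorm (fun k => y k `^ h) o.
Proof.
move=> x0 y0 M10 M20 H1 H2 o.
pose G := V ^t* *m dm C (fun i => x i `^ h) *m V.
pose D s := dm C (fun k => y k `^ s).
have DD s t : D s *m D t = D (s + t).
  by rewrite dm_mul; apply: eq_dm => k; rewrite powRD // (gt_eqF (y0 k)) implybT.
have D0 : D 0 = 1%:M by rewrite -dm1; apply: eq_dm => k; rewrite powRr0.
pose N := D (- (h / 2)) *m G *m D (- (h / 2)).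
have Nh : N \is hermsymmx.
  by apply/hermP; rewrite /N /G !tcM !tc_dm trmxCK !mulmxA.
pose P := spectralmx N; pose c := eigval N.
have Pu : P \is unitarymx by exact: spectral_unitarymx.
have Ne : N = specmx P c by rewrite specmx_eigval.
have cM i : c i <= Num.sqrt (M1 * M2).
  (* [w] is the i-th eigenvector of [N], so that [z] solves G z = c_i y^h z. *)
  pose w := col i (P ^t*); pose z := D (- (h / 2)) *m w.
  have Nw : N *m w = ofR C (c i) *: w.
    rewrite /w !colE Ne /specmx -!mulmxA (mulmxA P) unitaryR // mul1mx.
    rewrite scalemxAr; congr (_ *m _); apply/colP => k.
    rewrite mul_diag_mx !mxE; have [->//|] := eqVneq k i.
    by rewrite !mulr0.
  have Gz : G *m z = ofR C (c i) *: (D h *m z).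
    have -> : G *m z = D (h / 2) *m (N *m w).
      by rewrite /N /z !mulmxA DD subrr D0 mul1mx.
    by rewrite Nw -scalemxAr /z mulmxA DD; congr (_ *: (D _ *m _)); field.
  (* This [u] satisfies u^* G z = c_i b, and its form with exponent h - a is again [b];
     Cauchy-Schwarz then reads (c_i b)^2 <= M1 b M2 b. *)
  pose u := D a *m z; pose b := wnorm (fun k => y k `^ (h + a)) z.
  have b0 : 0 < b.
    have p0 k : 0 < y k `^ a by apply: powR_gt0.
    have -> : b = wnorm (fun k => y k `^ a) w.
      rewrite /b /z wnorm_dm; apply: eq_wnorm => k.
      rewrite -mulNr powR_half_sqr // -powRD ?(gt_eqF (y0 k)) ?implybT //.
      by congr (_ `^ _); ring.
    rewrite lt_neqAle wnorm_ge0 ?andbT => [|k]; last exact/ltW.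
    apply/negP => /eqP/esym/eqP; rewrite psumr_eq0 => [/allP h0|k _]; last first.
      by rewrite mulr_ge0 ?sqn_ge0 // ltW.
    have := unitary_row i Pu; rewrite big1 => [/eqP|k _].
      by rewrite eq_sym oner_eq0.
    have := h0 k (mem_index_enum _); rewrite /= mulf_eq0 (gt_eqF (p0 k)) orbF.
    by rewrite !mxE sqn_conj => /eqP.
  have e1 : reR ((u ^t* *m G *m z) 0 0) = c i * b.
    rewrite -mulmxA Gz -scalemxAr mxE /u tcM tc_dm -/(D a) mulmxA.
    rewrite -(mulmxA _ (D a)) DD reRM; congr (_ * _).
    by apply: (@ofR_inj _ C); rewrite /b wnormE (addrC h) -wnormE ofRK.
  have := cauchy_schwarz_dm (fun i => x i `^ ((h - a) / 2))
    (fun i => x i `^ ((h + a) / 2)) (V *m u) (V *m z).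
  have -> : dm C (fun i => x i `^ ((h - a) / 2) * x i `^ ((h + a) / 2)) =
      dm C (fun i => x i `^ h).
    apply: eq_dm => k; rewrite -powRD ?(gt_eqF (x0 k)) ?implybT //.
    by congr (_ `^ _); field.
  rewrite /G !mulmxA in e1; rewrite tcM !mulmxA e1.
  rewrite (eq_wnorm _ (fun i => powR_half_sqr (h - a) (x0 i))).
  rewrite (eq_wnorm _ (fun i => powR_half_sqr (h + a) (x0 i))) => cs.
  have hu := H1 u; have hz := H2 z; rewrite -/b in hz.
  have eu : wnorm (fun k => y k `^ (h - a)) u = b.
    rewrite /u wnorm_dm; apply: eq_wnorm => k; rewrite expr2 -!powRD;
      rewrite ?(gt_eqF (y0 k)) ?implybT //; by congr (_ `^ _); ring.
  rewrite eu in hu.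
  have le2 : (c i * b) ^+ 2 <= (M1 * b) * (M2 * b).
    rewrite -!mulmxA in cs; apply: le_trans cs _; apply: (ler_pM _ _ hu hz);
      by apply: wnorm_ge0 => j; apply: powR_ge0.
  have [c0|c0] := leP (c i) 0; first by rewrite (le_trans c0) ?sqrtr_ge0.
  rewrite -[c i]gtr0_norm // -sqrtr_sqr ler_sqrt ?mulr_ge0 //.
  by move: le2; rewrite exprMn [leRHS]mulrACA -(expr2 b) ler_pM2r ?exprn_gt0.
pose w := D (h / 2) *m o.
have <- : wnorm c (P *m w) = wnorm (fun i => x i `^ h) (V *m o).
  have wt : w ^t* = o ^t* *m D (h / 2) by rewrite tcM tc_dm.
  apply: (@ofR_inj _ C); rewrite wnorm_specmx -Ne wt wnormE tcM /w /N !mulmxA.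
  rewrite -(mulmxA (o ^t*) (D _)) DD subrr D0 mulmx1 -!mulmxA.
  by rewrite (mulmxA (D _) (D _) o) DD addNr D0 mul1mx /G !mulmxA.
have <- : wnorm (fun=> 1) (P *m w) = wnorm (fun k => y k `^ h) o.
  rewrite wnorm_isom ?unitaryC // /w wnorm_dm; apply: eq_wnorm => k.
  by rewrite mulr1 powR_half_sqr.
rewrite -wnormZ; apply: le_wnorm => i; by rewrite mulr1.
Qed.

Lemma bernoulli_expr (R : realType) (t : R) k : 0 <= t ->
  1 + k%:R * t <= (1 + t) ^+ k.
Proof.
move=> t0; elim: k => [|k IH]; first by rewrite mul0r addr0 expr0.
rewrite exprS; apply: le_trans (_ : (1 + t) * (1 + k%:R * t) <= _).
  have : 0 <= k%:R * t ^+ 2 by rewrite mulr_ge0 ?sqr_ge0.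
  rewrite -natr1; nra.
by rewrite ler_wpM2l // addr_ge0.
Qed.

(** Stands in for a limit in k: by Bernoulli r^(-k) grows at least linearly, so an Archimedean
    choice of k contradicts a > b. *)
Lemma le_of_contraction (R : realType) (a b c r : R) : 0 <= c -> 0 <= r < 1 ->
  (forall k, a <= b + c * r ^+ k) -> a <= b.
Proof.
move=> c0 /andP[r0 r1] H; rewrite leNgt; apply/negP => ba.
have d0 : 0 < a - b by rewrite subr_gt0.
have [rz|rn] := eqVneq r 0.
  by have := H 1%N; rewrite rz expr1 mulr0 addr0 leNgt ba.
have rp : 0 < r by rewrite lt_neqAle eq_sym rn.
have t0 : 0 < r^-1 - 1 by rewrite subr_gt0 invf_gt1.
have cd0 : 0 <= c / ((a - b) * (r^-1 - 1)) by rewrite divr_ge0 // mulr_ge0 // ltW.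
have := archi_boundP cd0; set k := Num.bound _ => hk.
have := bernoulli_expr k (ltW t0).
rewrite (_ : 1 + (r^-1 - 1) = r^-1) ?exprVn => [hb|]; last by ring.
have := H k; rewrite -lerBlDl => hd.
have rk : 0 < r ^+ k by rewrite exprn_gt0.
have h1 : (a - b) * (k%:R * (r^-1 - 1)) <= c.
  have -> : c = c * r ^+ k * (r ^+ k)^-1 by rewrite mulfK // gt_eqF.
  apply: ler_pM => //; [exact: ltW | by rewrite mulr_ge0 // ltW |].
  by apply: le_trans hb; rewrite lerDr.
move: hk; rewrite ltr_pdivrMr ?mulr_gt0 //; lra.
Qed.

Lemma wnorm_isom_dm (R : realType) (C : cplx R) m n (V : 'M[C]_(m, n)) x y o :
  V ^t* *m dm C x *m V = dm C y -> wnorm x (V *m o) = wnorm y o.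
Proof.
move=> Vxy; apply: (@ofR_inj _ C); rewrite !wnormE -Vxy tcM.
by rewrite !mulmxA.
Qed.

(** Hansen's inequality, an equality at h = 0 and h = 1. Every s in [0,1] is the midpoint of one of
    these endpoints and another exponent of [0,1], so a constant 1 + e valid on [0,1] improves to
    sqrt (1 + e) <= 1 + e / 2. *)
Lemma isom_powR_le_pos (R : realType) (C : cplx R) m n (V : 'M[C]_(m, n))
    (x : 'I_m -> R) (y : 'I_n -> R) h o :
  (forall i, 0 < x i) -> (forall k, 0 < y k) ->
  V ^t* *m V = 1%:M -> V ^t* *m dm C x *m V = dm C y -> 0 <= h <= 1 ->
  wnorm (fun i => x i `^ h) (V *m o) <= wnorm (fun k => y k `^ h) o.
Proof.
move=> x0 y0 Vi Vxy h01.
pose Bd e := forall h, 0 <= h <= 1 -> forall o,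
  wnorm (fun i => x i `^ h) (V *m o) <= (1 + e) * wnorm (fun k => y k `^ h) o.
have w0 (s : R) (v : 'cV[C]_n) : 0 <= wnorm (fun k => y k `^ s) v.
  by apply: wnorm_ge0 => k; apply: powR_ge0.
have B0 (v : 'cV[C]_n) : wnorm (fun i => x i `^ 0) (V *m v) <=
    1 * wnorm (fun k => y k `^ 0) v.
  rewrite mul1r (eq_wnorm _ (fun i => powRr0 (x i))) wnorm_isom //.
  by rewrite (eq_wnorm _ (fun i => powRr0 (y i))).
have B1 (v : 'cV[C]_n) : wnorm (fun i => x i `^ 1) (V *m v) <=
    1 * wnorm (fun k => y k `^ 1) v.
  rewrite mul1r (eq_wnorm _ (fun i => powRr1 (ltW (x0 i)))).
  by rewrite (eq_wnorm _ (fun i => powRr1 (ltW (y0 i)))) (wnorm_isom_dm _ Vxy).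
have sq e : 0 <= e -> Num.sqrt (1 + e) <= 1 + e / 2.
  move=> e0; rewrite -[leRHS]ger0_norm; last lra.
  by rewrite -sqrtr_sqr ler_wsqrtr //; have := sqr_ge0 (e / 2); rewrite sqrrD; lra.
have step e : 0 <= e -> Bd e -> Bd (e / 2).
  move=> e0 He s /andP[s0 s1] v.
  apply: le_trans (_ : Num.sqrt (1 + e) * wnorm (fun k => y k `^ s) v <= _); last first.
    by rewrite ler_wpM2r ?sq.
  have e1 : 0 <= 1 + e by rewrite addr_ge0.
  have [s2|s2] := leP (s + s) 1.
    rewrite -[1 + e]mul1r; apply: (@isom_powR_step _ _ _ _ _ _ _ s s) => //.
    - by rewrite subrr.
    - by apply: He; rewrite s2 addr_ge0.
  rewrite -[1 + e]mulr1; apply: (@isom_powR_step _ _ _ _ _ _ _ s (1 - s)) => //.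
    by apply: He; apply/andP; split; lra.
  by rewrite addrC subrK.
(* [X] bounds every x_i^s and [Y] every y_k^(-s) with s in [0,1], whence the initial constant X
   Y. *)
pose X := 1 + \sum_i x i; pose Y := 1 + \sum_k (y k)^-1.
have X0 : 1 <= X by rewrite lerDl sumr_ge0 // => i _; exact: ltW.
have Y0 : 1 <= Y by rewrite lerDl sumr_ge0 // => k _; rewrite invr_ge0 ltW.
have e0 : 0 <= X * Y - 1.
  by rewrite subr_ge0 -[leLHS]mulr1 ler_pM.
have Bi : Bd (X * Y - 1).
  move=> s /andP[s0 s1] v; rewrite addrC subrK.
  have p1 t : 0 < t -> t `^ s <= 1 + t.
    move=> t0; have := young_powR (ltW t0) ler01 s0 s1; rewrite powR1 !mulr1.
    by move/le_trans; apply; have : s * t <= t by [rewrite ger_pMl|]; lra.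
  apply: le_trans (_ : wnorm (fun=> X) (V *m v) <= _).
    apply: le_wnorm => i; apply: le_trans (p1 _ (x0 i)) _; rewrite lerD2l.
    by rewrite (bigD1 i) //= lerDl sumr_ge0 // => j _; exact: ltW.
  have -> : wnorm (fun=> X) (V *m v) = X * wnorm (fun=> 1) v.
    by rewrite -(wnorm_isom _ Vi) -wnormZ; apply: eq_wnorm => i; rewrite mulr1.
  rewrite -mulrA -!wnormZ; apply: le_wnorm => k; rewrite ler_wpM2l ?(le_trans ler01) //.
  have := p1 _ (_ : 0 < (y k)^-1); rewrite invr_gt0 => /(_ (y0 k)) h1.
  have yy : (y k)^-1 `^ s * y k `^ s = 1.
    by rewrite -powRM ?invr_ge0 ?(ltW (y0 k)) // mulVf ?powR1 // gt_eqF.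
  rewrite -yy ler_wpM2r ?powR_ge0 // (le_trans h1) // lerD2l.
  by rewrite (bigD1 k) //= lerDl sumr_ge0 // => j _; rewrite invr_ge0 ltW.
have Bk k : Bd ((X * Y - 1) * 2^-1 ^+ k).
  elim: k => [|k IH]; first by rewrite expr0 mulr1.
  rewrite exprSr mulrA; apply: step => //.
  by rewrite mulr_ge0 // exprn_ge0 // invr_ge0.
apply: (@le_of_contraction _ _ _ ((X * Y - 1) * wnorm (fun k => y k `^ h) o) 2^-1).
- by rewrite mulr_ge0.
- by apply/andP; split; lra.
- move=> k; apply: le_trans (Bk k h h01 o) _.
  by rewrite mulrDl mul1r mulrAC.
Qed.

(** With u = y^(r-1) o the left side [b] equals <V o, x V u>. Cauchy-Schwarz for x = x^(r/2)
    x^((2-r)/2) leaves the factor <V u, x^(2-r) V u>, which is at most [b] by Hansen's inequality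
    for 2 - r in [0,1]; one factor [b] then cancels. *)
Lemma isom_powR_ge_pos (R : realType) (C : cplx R) m n (V : 'M[C]_(m, n))
    (x : 'I_m -> R) (y : 'I_n -> R) r o :
  (forall i, 0 < x i) -> (forall k, 0 < y k) ->
  V ^t* *m V = 1%:M -> V ^t* *m dm C x *m V = dm C y -> 1 <= r <= 2 ->
  wnorm (fun k => y k `^ r) o <= wnorm (fun i => x i `^ r) (V *m o).
Proof.
move=> x0 y0 Vi Vxy /andP[r1 r2].
pose u := dm C (fun k => y k `^ (r - 1)) *m o; set b := wnorm _ o.
have := cauchy_schwarz_dm (fun i => x i `^ (r / 2))
  (fun i => x i `^ ((2 - r) / 2)) (V *m o) (V *m u).
rewrite (eq_wnorm _ (fun i => powR_half_sqr r (x0 i))).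
rewrite (eq_wnorm _ (fun i => powR_half_sqr (2 - r) (x0 i))).
have -> : dm C (fun i => x i `^ (r / 2) * x i `^ ((2 - r) / 2)) = dm C x.
  apply: eq_dm => i; rewrite -powRD ?(gt_eqF (x0 i)) ?implybT //.
  by rewrite -[RHS](powRr1 (ltW (x0 i))); congr (_ `^ _); field.
have -> : reR (((V *m o) ^t* *m dm C x *m (V *m u)) 0 0) = b.
  have -> : (V *m o) ^t* *m dm C x *m (V *m u) = o ^t* *m dm C y *m u.
    by rewrite -Vxy tcM !mulmxA.
  rewrite /u mulmxA -(mulmxA _ (dm C y)) dm_mul -wnormE ofRK.
  apply: eq_wnorm => k; rewrite -{1}(powRr1 (ltW (y0 k))).
  rewrite -powRD ?(gt_eqF (y0 k)) ?implybT //; by congr (_ `^ _); ring.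
have hb : wnorm (fun i => x i `^ (2 - r)) (V *m u) <= b.
  apply: le_trans (isom_powR_le_pos _ x0 y0 Vi Vxy _) _; first by apply/andP; split; lra.
  rewrite /u wnorm_dm le_eqVlt; apply/orP; left; apply/eqP.
  apply: eq_wnorm => k; rewrite expr2 -!powRD ?(gt_eqF (y0 k)) ?implybT //.
  by congr (_ `^ _); ring.
have b0 : 0 <= b by apply: wnorm_ge0 => k; apply: powR_ge0.
have a0 : 0 <= wnorm (fun i => x i `^ r) (V *m o).
  by apply: wnorm_ge0 => k; apply: powR_ge0.
move=> cs; have {cs} := le_trans cs (ler_wpM2l a0 hb).
have [-> //|bn] := eqVneq b 0.
by rewrite expr2 ler_pM2r // lt_neqAle eq_sym bn.
Qed.

(** A fraction in (0,1] does not decrease under the power h, and the fractions x / (x + y) and y /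
    (x + y) sum to 1. *)
Lemma powR_subadd (R : realType) (x y h : R) : 0 <= x -> 0 <= y -> 0 <= h <= 1 ->
  (x + y) `^ h <= x `^ h + y `^ h.
Proof.
move=> x0 y0 /andP[h0 h1]; have [s|s] := eqVneq (x + y) 0.
  move: s => /eqP; rewrite paddr_eq0 // => /andP[/eqP-> /eqP->].
  by rewrite addr0 lerDl powR_ge0.
have s0 : 0 < x + y by rewrite lt_neqAle eq_sym s addr_ge0.
have key t : 0 <= t -> t <= x + y -> t / (x + y) * (x + y) `^ h <= t `^ h.
  rewrite le_eqVlt => /predU1P[<- _|t0 ts]; first by rewrite !mul0r powR_ge0.
  have t1 : 0 < t / (x + y) <= 1 by rewrite divr_gt0 //= ler_pdivrMr // mul1r.
  apply: le_trans (_ : (t / (x + y)) `^ h * (x + y) `^ h <= _).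
    by rewrite ler_wpM2r ?powR_ge0 // ger1_powR.
  by rewrite -powRM ?divrK ?unitfE //; [rewrite ltW //; case/andP: t1 | exact: ltW].
have := lerD (key x x0 _) (key y y0 _); rewrite lerDl lerDr => /(_ y0 x0).
by rewrite -mulrDl -mulrDl divff // mul1r.
Qed.

Lemma isom_powR_le (R : realType) (C : cplx R) m n (V : 'M[C]_(m, n))
    (x : 'I_m -> R) (y : 'I_n -> R) h o :
  (forall i, 0 <= x i) -> (forall k, 0 <= y k) ->
  V ^t* *m V = 1%:M -> V ^t* *m dm C x *m V = dm C y -> 0 <= h <= 1 ->
  wnorm (fun i => x i `^ h) (V *m o) <= wnorm (fun k => y k `^ h) o.
Proof.
move=> x0 y0 Vi Vxy h01; have /andP[h0 h1] := h01.
have [hz|hn] := eqVneq h 0.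
  rewrite hz (eq_wnorm _ (fun i => powRr0 (x i))) wnorm_isom //.
  by rewrite (eq_wnorm _ (fun i => powRr0 (y i))).
have hp : 0 < h by rewrite lt_neqAle eq_sym hn.
set w := wnorm (fun=> 1) o.
have w0 : 0 <= w by apply: wnorm_ge0.
apply: (@le_of_contraction _ _ _ w 2^-1) => // [|k]; first by apply/andP; split; lra.
set d : R := 2^-1 ^+ k; have d0 : 0 < d by rewrite exprn_gt0 // invr_gt0.
(* Both spectra are shifted by e, which the isometry respects. Since e^h = 2^(-k), subadditivity
   leaves the geometric error w 2^(-k). *)
pose e := d `^ h^-1; have e0 : 0 < e by rewrite powR_gt0.
have eh : e `^ h = d by rewrite -powRrM mulVf // powRr1 // ltW.
have xe i : 0 < x i + e by rewrite ltr_wpDl.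
have ye i : 0 < y i + e by rewrite ltr_wpDl.
have dmD p (a : 'I_p -> R) : dm C (fun i => a i + e) = dm C a + ofR C e *: 1%:M.
  rewrite /dm; apply/matrixP => i j; rewrite !mxE.
  by rewrite rmorphD mulrnDl mulr_natr.
have Vxe : V ^t* *m dm C (fun i => x i + e) *m V = dm C (fun k => y k + e).
  by rewrite !dmD mulmxDr mulmxDl Vxy -scalemxAr mulmx1 -scalemxAl Vi.
apply: le_trans (le_trans (isom_powR_le_pos o xe ye Vi Vxe h01) _).
  by apply: le_wnorm => i; rewrite ge0_ler_powR ?nnegrE ?lerDl // ltW.
have -> : wnorm (fun k => y k `^ h) o + w * d = wnorm (fun k => y k `^ h + d) o.
  rewrite /w /wnorm mulr_suml -big_split; apply: eq_bigr => i _ /=.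
  by rewrite mulr1 mulrDr.
by apply: le_wnorm => i; rewrite -eh powR_subadd // ltW.
Qed.

(* With A = (<u_i|e_k>) and B = (<e_k|w_j>) this is the isometry
   e_k |-> sum_ij <u_i|e_k> <e_k|w_j> (i,j), whose compressions of p_i and d_j are
   the diagonals of the matrices with spectra p, d in the basis e. *)
Definition pairmx (R : realType) (C : cplx R) n (A B : 'M[C]_n) :
    'M[C]_(#|{: 'I_n * 'I_n}|, n) :=
  \matrix_(r, k) (A (enum_val r).1 k * B k (enum_val r).2).

Lemma sum_pair_enum (V : nmodType) n (F : 'I_n -> 'I_n -> V) :
  \sum_(r < #|{: 'I_n * 'I_n}|) F (enum_val r).1 (enum_val r).2 =
  \sum_i \sum_j F i j.
Proof. by rewrite pair_bigA (big_enum_val (A := {: 'I_n * 'I_n})). Qed.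

Lemma pairmx_isom (R : realType) (C : cplx R) n (A B : 'M[C]_n) :
  A \is unitarymx -> B \is unitarymx ->
  (pairmx A B) ^t* *m pairmx A B = 1%:M.
Proof.
move=> Au Bu; apply/matrixP => k l; rewrite !mxE.
pose F i j : C := conjC (A i k) * A i l * (B l j * conjC (B k j)).
transitivity (\sum_i \sum_j F i j).
  rewrite -sum_pair_enum; apply: eq_bigr => r _; rewrite !mxE /F rmorphM /=.
  ring.
have /matrixP/(_ k l) := unitaryC Au; rewrite !mxE => ea.
have /matrixP/(_ l k) := unitaryR Bu; rewrite !mxE => eb.
transitivity ((\sum_i conjC (A i k) * A i l) * (\sum_j B l j * conjC (B k j))).
  by rewrite mulr_suml; apply: eq_bigr => i _; rewrite mulr_sumr.
have -> : \sum_i conjC (A i k) * A i l = (k == l)%:R.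
  by rewrite -ea; apply: eq_bigr => i _; rewrite !mxE.
have -> : \sum_j B l j * conjC (B k j) = (l == k)%:R.
  by rewrite -eb; apply: eq_bigr => i _; rewrite !mxE.
by rewrite eq_sym; case: eqP => _; rewrite ?mulr1 ?mulr0.
Qed.

Lemma pairmx_dm (R : realType) (C : cplx R) n (A B : 'M[C]_n)
    (p d : 'I_n -> R) al be :
  A \is unitarymx -> B \is unitarymx ->
  let V := pairmx A B in
  V ^t* *m dm C (fun r => al * p (enum_val r).1 + be * d (enum_val r).2) *m V =
  dm C (fun k => al * reR (specmx A p k k) + be * reR (specmx (B ^t*) d k k)).
Proof.
move=> Au Bu V.
pose y k := al * reR (specmx A p k k) + be * reR (specmx (B ^t*) d k k).
rewrite -[RHS]/(dm C y); apply/matrixP => k l; rewrite /dm mul_mx_diag !mxE.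
pose F i j : C := ofR C al * (conjC (A i k) * ofR C (p i) * A i l *
   (B l j * conjC (B k j))) + ofR C be * (conjC (A i k) * A i l *
   (B l j * ofR C (d j) * conjC (B k j))).
transitivity (\sum_i \sum_j F i j).
  rewrite -sum_pair_enum; apply: eq_bigr => r _.
  rewrite !mxE /F rmorphD !rmorphM /=; ring.
have /matrixP/(_ k l) := unitaryC Au; rewrite !mxE => ea.
have /matrixP/(_ l k) := unitaryR Bu; rewrite !mxE => eb.
have ea' : \sum_i conjC (A i k) * A i l = (k == l)%:R.
  by rewrite -ea; apply: eq_bigr => i _; rewrite !mxE.
have eb' : \sum_j B l j * conjC (B k j) = (l == k)%:R.
  by rewrite -eb; apply: eq_bigr => i _; rewrite !mxE.
have sa : \sum_i conjC (A i k) * ofR C (p i) * A i l = specmx A p k l.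
  by rewrite specmx_entry.
have sb : \sum_j B l j * ofR C (d j) * conjC (B k j) = specmx (B ^t*) d l k.
  by rewrite specmx_entry; apply: eq_bigr => i _; rewrite !mxE conjCK.
(* In each term one of the two factors is a unitarity sum, hence a Kronecker delta: the compression
   is diagonal although the matrices with spectra [p] and [d] need not be. *)
transitivity (ofR C al * (specmx A p k l * (l == k)%:R) +
   ofR C be * ((k == l)%:R * specmx (B ^t*) d l k)).
  rewrite -ea' -eb' -sa -sb /F !mulr_suml !mulr_sumr -big_split /=.
  apply: eq_bigr => i _; rewrite !mulr_sumr -big_split /=.
  by apply: eq_bigr => j _.
rewrite (eq_sym l); have [<-|kl] := eqVneq k l; last first.
  by rewrite mul0r !mulr0 addr0 mulr0n.
have re (U : 'M[C]_n) a : ofR C (reR (specmx U a k k)) = specmx U a k k.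
  apply: reR_real; apply/CrealP.
  by have /hermP/matrixP/(_ k k) := specmx_herm U a; rewrite !mxE.
by rewrite mul1r mulr1 mulr1n /y rmorphD !rmorphM /= !re.
Qed.

Lemma pairmx_dgl (R : realType) (C : cplx R) n (E U W : 'M[C]_n)
    (p d : 'I_n -> R) al be :
  E \is unitarymx -> U \is unitarymx -> W \is unitarymx ->
  let V := pairmx (U *m E ^t*) (E *m W ^t*) in
  V ^t* *m dm C (fun r => al * p (enum_val r).1 + be * d (enum_val r).2) *m V =
  dm C (fun k => al * dgl E (specmx U p) k + be * dgl E (specmx W d) k).
Proof.
move=> Eu Uu Wu; rewrite /= pairmx_dm; try exact: unitaryM_tc.
by rewrite tcM trmxCK; apply: eq_dm => k; rewrite /dgl !specmx_conj.
Qed.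

(** The image of the vector [o] lists the matrix elements of [specmx E o] between the two other
    bases; this pairs the weights o_k^2 with squared matrix elements. *)
Lemma pairmx_wnorm (R : realType) (C : cplx R) n (E U W : 'M[C]_n)
    (o : 'I_n -> R) (f : 'I_n -> 'I_n -> R) :
  wnorm (fun r => f (enum_val r).1 (enum_val r).2)
    (pairmx (U *m E ^t*) (E *m W ^t*) *m (\col_k ofR C (o k))) =
  \sum_i \sum_j sqn ((U *m specmx E o *m W ^t*) i j) * f i j.
Proof.
rewrite -sum_pair_enum; apply: eq_bigr => r _; congr (sqn _ * _).
rewrite /specmx !mulmxA -(mulmxA _ E) mul_mx_diag !mxE.
by apply: eq_bigr => k _; rewrite !mxE mulrAC.
Qed.

Lemma wnorm_col (R : realType) (C : cplx R) n (o a : 'I_n -> R) :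
  wnorm a (\col_k ofR C (o k)) = \sum_k o k ^+ 2 * a k.
Proof. by apply: eq_bigr => k _; rewrite mxE sqnR. Qed.

Lemma pair_powR_le (R : realType) (C : cplx R) n (E U W : 'M[C]_n)
    (o p d : 'I_n -> R) al be h :
  E \is unitarymx -> U \is unitarymx -> W \is unitarymx ->
  (forall i, 0 <= p i) -> (forall i, 0 <= d i) -> 0 <= al -> 0 <= be ->
  0 <= h <= 1 ->
  \sum_i \sum_j sqn ((U *m specmx E o *m W ^t*) i j) * (al * p i + be * d j) `^ h
  <= \sum_k o k ^+ 2 *
       (al * dgl E (specmx U p) k + be * dgl E (specmx W d) k) `^ h.
Proof.
move=> Eu Uu Wu p0 d0 a0 b0 h01.
rewrite -(pairmx_wnorm _ _ _ _ (fun i j => (al * p i + be * d j) `^ h)).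
rewrite -(wnorm_col C); apply: isom_powR_le => //.
- by move=> r; rewrite addr_ge0 // mulr_ge0.
- by move=> k; rewrite addr_ge0 // mulr_ge0 // dgl_ge0 //; apply: psd_specmx.
- by apply: pairmx_isom; apply: unitaryM_tc.
- exact: pairmx_dgl.
Qed.

Lemma pair_powR_ge (R : realType) (C : cplx R) n (E U W : 'M[C]_n)
    (o p d : 'I_n -> R) al be r :
  E \is unitarymx -> U \is unitarymx -> W \is unitarymx ->
  (forall i j, 0 < al * p i + be * d j) ->
  (forall k, 0 < al * dgl E (specmx U p) k + be * dgl E (specmx W d) k) ->
  1 <= r <= 2 ->
  \sum_k o k ^+ 2 *
       (al * dgl E (specmx U p) k + be * dgl E (specmx W d) k) `^ r
  <= \sum_i \sum_j sqn ((U *m specmx E o *m W ^t*) i j) * (al * p i + be * d j) `^ r.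
Proof.
move=> Eu Uu Wu x0 y0 r12.
rewrite -(pairmx_wnorm _ _ _ _ (fun i j => (al * p i + be * d j) `^ r)).
rewrite -(wnorm_col C); apply: isom_powR_ge_pos => //.
- by apply: pairmx_isom; apply: unitaryM_tc.
- exact: pairmx_dgl.
Qed.

Lemma convex_gt0 (R : realType) (t a b : R) : 0 <= t -> t <= 1 -> 0 < a -> 0 < b ->
  0 < (1 - t) * a + t * b.
Proof.
move=> t0 t1 a0 b0; have [->|tn] := eqVneq t 0; first by rewrite subr0 mul0r addr0 mul1r.
apply: ltr_wpDl; first by rewrite mulr_ge0 ?subr_ge0 // ltW.
by rewrite mulr_gt0 // lt_neqAle eq_sym tn.
Qed.

Lemma specmxD (R : realType) (C : cplx R) n (U : 'M[C]_n) a b :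
  specmx U (fun i => a i + b i) = specmx U a + specmx U b.
Proof.
rewrite /specmx -mulmxDl -mulmxDr -linearD /=; congr (_ *m diag_mx _ *m _).
by apply/rowP => i; rewrite !mxE rmorphD.
Qed.

Lemma specmx_cst (R : realType) (C : cplx R) n (U : 'M[C]_n) e :
  U \is unitarymx -> specmx U (fun=> e) = ofR C e *: 1%:M.
Proof.
move=> Uu; rewrite -(specmx1 Uu) /specmx scalemxAl scalemxAr.
congr (_ *m _ *m _); apply/matrixP => i j; rewrite !mxE rmorph1.
by rewrite mulr_natr.
Qed.

Lemma dgl_cst (R : realType) (C : cplx R) n (U V : 'M[C]_n) e k :
  U \is unitarymx -> V \is unitarymx -> dgl V (specmx U (fun=> e)) k = e.
Proof.
move=> Uu Vu; rewrite dglE -mulr_suml unitary_col ?mul1r //.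
exact: unitaryM_tc.
Qed.

Lemma dglN (R : realType) (C : cplx R) n (V A : 'M[C]_n) k :
  dgl V (- A) k = - dgl V A k.
Proof.
apply/eqP; rewrite -addr_eq0 -dglD addNr /dgl mulmx0 mul0mx mxE.
by rewrite -(rmorph0 (ofR C)) ofRK.
Qed.

(** Each matrix is diagonal on its own side, so the difference has matrix elements <u_i|w_j> (p_i -
    d_j): the origin of the second-order weights. *)
Lemma specmx_diff (R : realType) (C : cplx R) n (U W : 'M[C]_n) p d i j :
  U \is unitarymx -> W \is unitarymx ->
  sqn ((U *m (specmx U p - specmx W d) *m W ^t*) i j) =
  sqn ((U *m W ^t*) i j) * (p i - d j) ^+ 2.
Proof.
move=> Uu Wu; rewrite mulmxBr mulmxBl /specmx.
rewrite -[X in (X - _)]mulmxA !mulmxA unitaryR // mul1mx.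
rewrite -(mulmxA _ W) unitaryR // mulmx1 -mulmxA mul_diag_mx mul_mx_diag.
rewrite !mxE -[X in X - _]mulrC -mulrBr -rmorphB sqnM sqnR //.
Qed.

(** Klein's identity: for P and D with spectra [p] and [d], the scalar Taylor remainders add up to
    Tr P^q - Tr D^q - q Tr D^(q-1) (P - D). The form d + (p - d) matches [taylor_powR_sum]. *)
Lemma bregman_sum (R : realType) (C : cplx R) n (U W : 'M[C]_n) p d q :
  U \is unitarymx -> W \is unitarymx ->
  \sum_i \sum_j sqn ((U *m W ^t*) i j) *
    ((d j + (p i - d j)) `^ q - d j `^ q - q * d j `^ (q - 1) * (p i - d j)) =
  \sum_i p i `^ q - \sum_j d j `^ q
  - \sum_j q * d j `^ (q - 1) * dgl W (specmx U p - specmx W d) j.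
Proof.
move=> Uu Wu; set T := U *m W ^t*.
have Tu : T \is unitarymx by exact: unitaryM_tc.
transitivity (\sum_i \sum_j sqn (T i j) * p i `^ q
   - \sum_j \sum_i sqn (T i j) * d j `^ q
   - \sum_j \sum_i (q * d j `^ (q - 1)) * (sqn (T i j) * (p i - d j))).
  rewrite [X in _ = _ - X - _]exchange_big [X in _ = _ - _ - X]exchange_big /=.
  rewrite -!sumrB; apply: eq_bigr => i _; rewrite -!sumrB; apply: eq_bigr => j _.
  by rewrite (addrC (d j)) subrK; ring.
congr (_ - _ - _).
- by apply: eq_bigr => i _; rewrite -mulr_suml unitary_row // mul1r.
- by apply: eq_bigr => j _; rewrite -mulr_suml unitary_col // mul1r.
apply: eq_bigr => j _; rewrite -mulr_sumr; congr (_ * _).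
have -> : dgl W (specmx U p - specmx W d) j =
    dgl W (specmx U p) j - dgl W (specmx W d) j.
  by apply/(canRL (addrK _)); rewrite -dglD subrK.
rewrite dglE dgl_eig // -/T -[in RHS](mul1r (d j)) -(unitary_col j Tu).
by rewrite mulr_suml -sumrB; apply: eq_bigr => i _; rewrite mulrBr.
Qed.

(** A single Taylor estimate on four families: the remainders of D + O and D - O, minus those of the
    scalars b_k + o_k and b_k - o_k. First-order terms cancel between the two signs; second
    derivatives compare by operator convexity of x^(q-2), then by b_k <= D_kk. *)
Lemma star_34_pos (R : realType) (C : cplx R) n (U U' W E : 'M[C]_n)
    (p p' d o b : 'I_n -> R) q :
  U \is unitarymx -> U' \is unitarymx -> W \is unitarymx -> E \is unitarymx ->
  specmx U p - specmx W d = specmx E o ->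
  specmx U' p' - specmx W d = - specmx E o ->
  (forall i, 0 < p i) -> (forall i, 0 < p' i) -> (forall j, 0 < d j) ->
  (forall k, `|o k| < b k) -> (forall k, b k <= dgl E (specmx W d) k) ->
  3 <= q <= 4 ->
  2 * \sum_j d j `^ q +
    \sum_k ((b k + o k) `^ q + (b k - o k) `^ q - 2 * b k `^ q) <=
  \sum_i p i `^ q + \sum_i p' i `^ q.
Proof.
move=> Uu Uu' Wu Eu hP hQ p0 p0' d0 ob bd /andP[q3 q4].
pose T := U *m W ^t*; pose T' := U' *m W ^t*.
pose I : finType := (('I_n * 'I_n) + ('I_n * 'I_n) + ('I_n + 'I_n))%type.
pose c (r : I) : R := match r with
  | inl (inl (i, j)) => sqn (T i j) | inl (inr (i, j)) => sqn (T' i j)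
  | inr _ => -1 end.
pose x (r : I) : R := match r with
  | inl (inl (i, j)) => d j | inl (inr (i, j)) => d j
  | inr (inl k) => b k | inr (inr k) => b k end.
pose y (r : I) : R := match r with
  | inl (inl (i, j)) => p i - d j | inl (inr (i, j)) => p' i - d j
  | inr (inl k) => o k | inr (inr k) => - o k end.
have b0 k : 0 < b k := le_lt_trans (normr_ge0 _) (ob k).
have ob1 k : 0 < b k + o k by have := ob k; rewrite ltr_norml; lra.
have ob2 k : 0 < b k - o k by have := ob k; rewrite ltr_norml; lra.
have sumI (F : I -> R) : \sum_r F r =
    (\sum_i \sum_j F (inl (inl (i, j))) + \sum_i \sum_j F (inl (inr (i, j)))) +
    (\sum_k F (inr (inl k)) + \sum_k F (inr (inr k))).
  by rewrite !big_sumType /= !pair_bigA; congr (_ + _ + _); apply: eq_bigr => -[].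
have q2 : 2 <= q by lra.
have x0 r : 0 < x r by case: r => [[[i j]|[i j]]|[k|k]] /=.
have xy0 r : 0 < x r + y r.
  by case: r => [[[i j]|[i j]]|[k|k]] /=; rewrite ?(addrC (d _)) ?subrK.
have cond t : 0 <= t <= 1 ->
    0 <= \sum_r c r * y r ^+ 2 * (x r + t * y r) `^ (q - 2).
  move=> /andP[t0 t1]; rewrite sumI /=.
  (* One sign at a time: d_j + t (r_i - d_j) is a convex combination of two spectra, and the same
     combination of the diagonals in the basis [E] is D_kk + t s_k. *)
  have hp (V : 'M[C]_n) r s : V \is unitarymx -> (forall i, 0 < r i) ->
      specmx V r - specmx W d = specmx E s -> (forall k, 0 < b k + t * s k) ->
      \sum_k s k ^+ 2 * (b k + t * s k) `^ (q - 2) <=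
      \sum_i \sum_j sqn ((V *m W ^t*) i j) * (r i - d j) ^+ 2 *
        (d j + t * (r i - d j)) `^ (q - 2).
    move=> Vu r0 hV bs.
    have e1 k : t * dgl E (specmx V r) k + (1 - t) * dgl E (specmx W d) k =
        dgl E (specmx W d) k + t * s k.
      have -> : specmx V r = specmx W d + specmx E s by rewrite -hV addrC subrK.
      by rewrite dglD dgl_eig //; ring.
    have pos k : 0 < dgl E (specmx W d) k + t * s k.
      by apply: lt_le_trans (bs k) _; rewrite lerD2r.
    apply: le_trans (_ : _ <= \sum_k s k ^+ 2 *
       (t * dgl E (specmx V r) k + (1 - t) * dgl E (specmx W d) k) `^ (q - 2)) _.
      apply: ler_sum => k _; rewrite ler_wpM2l ?sqr_ge0 // e1.
      rewrite ge0_ler_powR ?nnegrE ?lerD2r ?(ltW (bs k)) ?(ltW (pos k)) //; lra.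
    apply: le_trans (pair_powR_ge _ Eu Vu Wu _ _ _) _.
    + by move=> i j; rewrite addrC convex_gt0.
    + by move=> k; rewrite e1.
    + by apply/andP; split; lra.
    rewrite le_eqVlt; apply/orP; left; apply/eqP.
    apply: eq_bigr => i _; apply: eq_bigr => j _.
    rewrite -hV specmx_diff //; congr (_ * _ `^ _); ring.
  have bt1 k : 0 < b k + t * o k.
    have := convex_gt0 t0 t1 (b0 k) (ob1 k); congr (_ < _); ring.
  have bt2 k : 0 < b k + t * - o k.
    have := convex_gt0 t0 t1 (b0 k) (ob2 k); congr (_ < _); ring.
  have hQ' : specmx U' p' - specmx W d = specmx E (fun k => - o k).
    rewrite hQ; apply/matrixP => i j; rewrite mxE !specmx_entry -sumrN.
    by apply: eq_bigr => k _; rewrite rmorphN mulrN mulNr.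
  have := lerD (hp U p o Uu p0 hP bt1) (hp U' p' _ Uu' p0' hQ' bt2).
  rewrite -subr_ge0 => h; apply: le_trans h _.
  rewrite lerD2l opprD -!sumrN le_eqVlt; apply/orP; left; apply/eqP.
  by congr (_ + _); apply: eq_bigr => k _; rewrite mulN1r mulNr.
have := taylor_powR_sum q2 x0 xy0 cond; rewrite sumI /=.
rewrite !bregman_sum // hP hQ.
have cancel_lin : \sum_j q * d j `^ (q - 1) * dgl W (- specmx E o) j =
    - \sum_j q * d j `^ (q - 1) * dgl W (specmx E o) j.
  by rewrite -sumrN; apply: eq_bigr => j _; rewrite dglN mulrN.
rewrite cancel_lin.
have : \sum_k -1 * ((b k + o k) `^ q - b k `^ q - q * b k `^ (q - 1) * o k) +
  \sum_k -1 * ((b k - o k) `^ q - b k `^ q - q * b k `^ (q - 1) * - o k) =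
  - \sum_k ((b k + o k) `^ q + (b k - o k) `^ q - 2 * b k `^ q).
  by rewrite -big_split -sumrN; apply: eq_bigr => k _ /=; ring.
move=> ->; lra.
Qed.

(* A rate of convergence at 0+ that survives finite sums; it replaces limits when
   a positive definite perturbation is removed. *)
Definition lip0 (R : realType) (F : R -> R) (l : R) : Prop :=
  exists2 K, 0 <= K & forall e, 0 < e <= 1 -> `|F e - l| <= K * e.

Lemma lip0_powR (R : realType) (q x : R) : 1 <= q -> 0 <= x ->
  lip0 (fun e => (x + e) `^ q) (x `^ q).
Proof.
move=> q1 x0; have q0 : 0 <= q by lra.
exists (q * (x + 1) `^ (q - 1)); first by rewrite mulr_ge0 ?powR_ge0.
move=> e /andP[e0 e1]; have xe0 : 0 <= x + e by rewrite addr_ge0 // ltW.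
have h1 : x `^ q <= (x + e) `^ q by rewrite ge0_ler_powR ?nnegrE ?lerDl // ltW.
have h2 := powR_tangent_ge1 q1 x0 xe0.
have h3 : (x + e) `^ (q - 1) <= (x + 1) `^ (q - 1).
  by rewrite ge0_ler_powR ?nnegrE ?subr_ge0 ?lerD2l // addr_ge0.
rewrite ger0_norm ?subr_ge0 //.
apply: le_trans (_ : q * (x + e) `^ (q - 1) * e <= _).
  move: h2; rewrite opprD addrA subrr sub0r mulrN; lra.
by rewrite ler_wpM2r ?ler_wpM2l // ltW.
Qed.

Lemma lip0D (R : realType) (F G : R -> R) l m : lip0 F l -> lip0 G m ->
  lip0 (fun e => F e + G e) (l + m).
Proof.
move=> [K K0 hK] [L L0 hL]; exists (K + L); first by rewrite addr_ge0.
move=> e he; have -> : F e + G e - (l + m) = (F e - l) + (G e - m) by ring.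
by rewrite (le_trans (ler_normD _ _)) // mulrDl lerD ?hK ?hL.
Qed.

Lemma lip0Z (R : realType) (F : R -> R) l k : lip0 F l ->
  lip0 (fun e => k * F e) (k * l).
Proof.
move=> [K K0 hK]; exists (`|k| * K); first by rewrite mulr_ge0.
by move=> e he; rewrite -mulrBr normrM -mulrA ler_wpM2l ?hK.
Qed.

Lemma lip0_sum (R : realType) (I : finType) (F : I -> R -> R) l :
  (forall i, lip0 (F i) (l i)) -> lip0 (fun e => \sum_i F i e) (\sum_i l i).
Proof.
move=> H.
elim: (index_enum I) => [|i r IH].
  by exists 0 => // e _; rewrite !big_nil subrr normr0 mul0r.
have [K K0 hK] := lip0D (H i) IH; exists K => // e he.
by rewrite !big_cons; apply: hK.
Qed.

Lemma lip0_le (R : realType) (F G : R -> R) l m : lip0 F l -> lip0 G m ->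
  (forall e, 0 < e -> F e <= G e) -> l <= m.
Proof.
move=> [K K0 hK] [L L0 hL] FG.
apply: (@le_of_contraction _ _ _ (K + L) 2^-1) => [||k].
- by rewrite addr_ge0.
- by apply/andP; split; lra.
set e : R := 2^-1 ^+ k; have e0 : 0 < e by rewrite exprn_gt0 // invr_gt0.
have e1 : e <= 1 by rewrite exprn_ile1 ?invr_ge0 // invf_le1 ?ler1n.
have e01 : 0 < e <= 1 by rewrite e0.
have := hK e e01; have := hL e e01; have := FG e e0.
rewrite !ler_norml mulrDl; lra.
Qed.

(** * The symmetric form of (ii) *)

Definition star (R : realType) (C : cplx R) (q : R) : Prop :=
  forall n (D O : 'M[C]_n), D \is hermsymmx -> O \is hermsymmx ->
  psd (D + O) -> psd (D - O) ->
  2 * trp q D + (2 `^ q - 2) * trfun (fun x => `|x| `^ q) O <=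
  trp q (D + O) + trp q (D - O).

Lemma star_dgl (R : realType) (C : cplx R) n (D O E : 'M[C]_n) k :
  psd (D + O) -> psd (D - O) -> `|dgl E O k| <= dgl E D k.
Proof.
move=> hP hQ; have := dgl_ge0 E k hP; have := dgl_ge0 E k hQ.
by rewrite !dglD dglN ler_norml; lra.
Qed.

Lemma star_psd (R : realType) (C : cplx R) n (D O : 'M[C]_n) :
  D \is hermsymmx -> psd (D + O) -> psd (D - O) -> psd D.
Proof.
move=> Dh hP hQ; apply: psd_dgl => // V k _.
exact: le_trans (normr_ge0 _) (star_dgl V k hP hQ).
Qed.

Lemma star_34 (R : realType) (C : cplx R) q : 3 <= q <= 4 -> star C q.
Proof.
move=> q34 n D O Dh Oh hP hQ; have hD := star_psd Dh hP hQ.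
have q1 : 1 <= q by case/andP: q34; lra.
pose U := spectralmx (D + O); pose p := eigval (D + O).
pose U' := spectralmx (D - O); pose p' := eigval (D - O).
pose W := spectralmx D; pose d := eigval D.
pose E := spectralmx O; pose o := eigval O.
have [Uu Uu' Wu Eu] : [/\ U \is unitarymx, U' \is unitarymx, W \is unitarymx &
  E \is unitarymx] by split; apply: spectral_unitarymx.
have p0 i : 0 <= p i by case: hP.
have p'0 i : 0 <= p' i by case: hQ.
have d0 i : 0 <= d i by case: hD.
have eP : specmx U p = D + O by apply: specmx_eigval; case: hP.
have eQ : specmx U' p' = D - O by apply: specmx_eigval; case: hQ.
have eD : specmx W d = D by apply: specmx_eigval.
have eO : specmx E o = O by apply: specmx_eigval.
(* [star_34_pos] is applied with b_k = |o_k| + e and all three spectra shifted by e. At e = 0 one of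
   |o_k| + o_k, |o_k| - o_k is 0 and the other 2 |o_k|. *)
pose F e := 2 * \sum_j (d j + e) `^ q + \sum_k ((`|o k| + o k + e) `^ q +
    (`|o k| - o k + e) `^ q + (-2) * (`|o k| + e) `^ q).
pose G e := \sum_i (p i + e) `^ q + \sum_i (p' i + e) `^ q.
have -> : 2 * trp q D + (2 `^ q - 2) * trfun (fun x => `|x| `^ q) O =
  2 * \sum_j d j `^ q + \sum_k ((`|o k| + o k) `^ q +
    (`|o k| - o k) `^ q + (-2) * `|o k| `^ q).
  congr (_ + _); rewrite /trfun mulr_sumr; apply: eq_bigr => k _.
  have q0 : q != 0 by rewrite gt_eqF //; lra.
  rewrite -/o; have [ok|ok] := leP 0 (o k).
    rewrite ger0_norm // subrr powR0 //.
    rewrite (_ : o k + o k = 2 * o k) ?powRM //; ring.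
  rewrite ltr0_norm // addNr powR0 //.
  rewrite (_ : - o k - o k = 2 * - o k) ?powRM // ?oppr_ge0 ?ltW //; ring.
apply: (@lip0_le _ F G).
- apply: lip0D; first by apply: lip0Z; apply: lip0_sum => i; apply: lip0_powR.
  apply: lip0_sum => k; apply: lip0D; last by apply: lip0Z; apply: lip0_powR.
  apply: lip0D; apply: lip0_powR => //; have := ler_norm (o k);
    have := ler_norm (- o k); rewrite normrN; lra.
- by apply: lip0D; apply: lip0_sum => i; apply: lip0_powR.
move=> e e0.
have sh (X : 'M[C]_n) x : X \is unitarymx ->
    specmx X (fun i => x i + e) = specmx X x + ofR C e *: 1%:M.
  by move=> Xu; rewrite specmxD specmx_cst.
have := @star_34_pos _ C n U U' W E (fun i => p i + e) (fun i => p' i + e)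
  (fun i => d i + e) o (fun k => `|o k| + e) q Uu Uu' Wu Eu.
rewrite !sh // eP eQ eD eO => /(_ _ _ _ _ _ _ _ q34) h.
apply: le_trans (h _ _ _ _ _ _ _).
- rewrite /F lerD2l le_eqVlt; apply/orP; left; apply/eqP.
  apply: eq_bigr => k _; rewrite (addrAC _ _ e) (addrAC _ (- o k) e); ring.
- by rewrite opprD addrACA subrr addr0 addrAC subrr add0r.
- by rewrite opprD addrACA subrr addr0 addrAC subrr add0r.
- by move=> i; rewrite ltr_wpDl.
- by move=> i; rewrite ltr_wpDl.
- by move=> i; rewrite ltr_wpDl.
- by move=> k; rewrite ltrDl.
move=> k; rewrite -(specmx_cst e Wu) dglD dgl_cst // lerD2r.
have := star_dgl E k hP hQ; rewrite -{1}eO dgl_eig //.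
Qed.

(** * Equivalence of the symmetric form and the block form *)

(** Arbitrary factors instead of square roots: [blk_star] uses factors of twice the size, and
    [star_double] takes X = O, which need not be positive. *)
Definition blk (R : realType) (C : cplx R) (q : R) : Prop :=
  forall n (X Y : 'M[C]_n),
  trp q (X *m X ^t*) + trp q (Y *m Y ^t*) +
    (2 `^ q - 2) * trp (q / 2) (X ^t* *m Y *m (X ^t* *m Y) ^t*)
  <= trp q (X *m X ^t* + Y *m Y ^t*).

Lemma char_poly_block (F : fieldType) m n (A : 'M[F]_m) (B : 'M[F]_n) :
  char_poly (block_mx A 0 0 B) = char_poly A * char_poly B.
Proof.
rewrite /char_poly -(det_ublock _ 0); congr (\det _).
rewrite /char_poly_mx map_block_mx !map_mx0 scalar_mx_block.
by rewrite opp_block_mx add_block_mx !oppr0 !addr0.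
Qed.

Lemma tc_block (C : numClosedFieldType) m1 m2 n1 n2 (A : 'M[C]_(m1, n1))
    (B : 'M[C]_(m1, n2)) (X : 'M[C]_(m2, n1)) (Y : 'M[C]_(m2, n2)) :
  (block_mx A B X Y) ^t* = block_mx (A ^t*) (X ^t*) (B ^t*) (Y ^t*).
Proof. by rewrite tr_block_mx map_block_mx. Qed.

Lemma herm_block (C : numClosedFieldType) m n (A : 'M[C]_m) (B : 'M[C]_n) Z :
  A \is hermsymmx -> B \is hermsymmx ->
  block_mx A Z (Z ^t*) B \is hermsymmx.
Proof.
by move=> /hermP a /hermP b; apply/hermP; rewrite tc_block a b trmxCK.
Qed.

Lemma trfun_block (R : realType) (C : cplx R) m n (A : 'M[C]_m) (B : 'M[C]_n) f :
  A \is hermsymmx -> B \is hermsymmx ->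
  trfun f (block_mx A 0 0 B) = trfun f A + trfun f B.
Proof.
move=> Ah Bh; pose b := row_mx (\row_i eigval A i) (\row_i eigval B i).
rewrite (@trfun_eig _ _ _ _ f (b 0)).
- rewrite big_split_ord /=; congr (_ + _); apply: eq_bigr => i _.
    by rewrite row_mxEl mxE.
  by rewrite row_mxEr mxE.
- by have := herm_block 0 Ah Bh; rewrite tc0.
rewrite char_poly_block -{1}(specmx_eigval Ah) -{1}(specmx_eigval Bh).
rewrite !char_poly_specmx ?spectral_unitarymx // big_split_ord /=.
congr (_ * _); apply: eq_bigr => i _; first by rewrite row_mxEl mxE.
by rewrite row_mxEr mxE.
Qed.

Lemma trfun0 (R : realType) (C : cplx R) n f : f 0 = 0 ->
  trfun f (0 : 'M[C]_n) = 0.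
Proof.
move=> f0; rewrite (_ : (0 : 'M[C]_n) = specmx 1%:M (fun=> 0)).
  by rewrite trfun_specmx ?unitary1 // big1.
by rewrite specmx_cst ?unitary1 // rmorph0 scale0r.
Qed.

Lemma herm0 (C : numClosedFieldType) n : (0 : 'M[C]_n) \is hermsymmx.
Proof. by apply/hermP; rewrite tc0. Qed.

Lemma trfun_block0 (R : realType) (C : cplx R) m n (A : 'M[C]_m) f :
  A \is hermsymmx -> f 0 = 0 -> trfun f (block_mx A 0 0 (0 : 'M[C]_n)) = trfun f A.
Proof. by move=> Ah f0; rewrite trfun_block ?herm0 // trfun0 ?addr0. Qed.

Lemma powR_sqr_half (R : realType) (x q : R) : (x ^+ 2) `^ (q / 2) = `|x| `^ q.
Proof.
rewrite -real_normK ?num_real // -powR_mulrn // -powRrM.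
by congr (_ `^ _); field.
Qed.

Lemma trp_sqr (R : realType) (C : cplx R) n (O : 'M[C]_n) q : O \is hermsymmx ->
  trp (q / 2) (O *m O) = trfun (fun x => `|x| `^ q) O.
Proof.
move=> Oh; rewrite -{1 2}(specmx_eigval Oh) specmx_mul ?spectral_unitarymx //.
rewrite trfun_specmx ?spectral_unitarymx //; apply: eq_bigr => i _.
by rewrite -expr2 powR_sqr_half.
Qed.

Lemma block0_sqr (F : pzRingType) n (A : 'M[F]_n) :
  block_mx A 0 0 (0 : 'M[F]_n) *m block_mx A 0 0 (0 : 'M[F]_n) =
  block_mx (A *m A) 0 0 0.
Proof. by rewrite mulmx_block !mul0mx mulmx0 !addr0. Qed.

Lemma half_le (R : realType) (a b c e k : R) :
  2 * (a + b) + k * (c + c) <= e + e -> a + b + k * c <= e.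
Proof. lra. Qed.

(** For the block row W = (X, T), W^* W is D + O when T = Y and D - O when T = -Y, whereas W W^* is
    X X^* + Y Y^* padded by zeros in both cases. Every trace then occurs twice, and [half_le]
    halves. *)
Lemma star_blk (R : realType) (C : cplx R) q : 0 < q -> star C q -> blk C q.
Proof.
move=> q0 S n X Y; set Z := X ^t* *m Y.
have pq0 : (0 : R) `^ q = 0 by rewrite powR0 // gt_eqF.
pose D := block_mx (X ^t* *m X) 0 0 (Y ^t* *m Y).
pose O := block_mx 0 Z (Z ^t*) 0.
have gh (T : 'M[C]_n) : T ^t* *m T \is hermsymmx.
  by rewrite -{2}[T]trmxCK herm_gram.
have Dh : D \is hermsymmx by have := herm_block 0 (gh X) (gh Y); rewrite tc0.
have Oh : O \is hermsymmx by apply: herm_block; apply: herm0.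
pose W T : 'M[C]_(n + n) := block_mx X T 0 0.
have eW T : (W T) ^t* *m W T =
    block_mx (X ^t* *m X) (X ^t* *m T) (T ^t* *m X) (T ^t* *m T).
  by rewrite /W tc_block !tc0 mulmx_block !mul0mx !addr0.
have pW T : psd ((W T) ^t* *m W T).
  by rewrite -{2}[W T]trmxCK; apply: psd_gram.
have tW T : trp q ((W T) ^t* *m W T) = trp q (X *m X ^t* + T *m T ^t*).
  rewrite trfun_gramC /W tc_block !tc0 mulmx_block !mulmx0 !mul0mx !addr0.
  by rewrite trfun_block0 // hermD ?herm_gram.
have eP : D + O = (W Y) ^t* *m W Y.
  by rewrite eW add_block_mx !addr0 !add0r /Z tcM trmxCK.
have eQ : D - O = (W (- Y)) ^t* *m W (- Y).
  rewrite eW opp_block_mx add_block_mx !oppr0 !addr0 !add0r /Z tcM trmxCK.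
  by rewrite tcN !mulmxN !mulNmx opprK.
have := S _ D O Dh Oh; rewrite eP eQ !tW => /(_ (pW _) (pW _)).
rewrite tcN mulmxN mulNmx opprK -(trp_sqr _ Oh) trfun_block // !trfun_gramC.
have -> : O *m O = block_mx (Z *m Z ^t*) 0 0 (Z ^t* *m Z).
  by rewrite mulmx_block !mulmx0 !mul0mx !addr0 !add0r.
rewrite trfun_block; [|exact: herm_gram|exact: gh].
by rewrite trfun_gramC; apply: half_le.
Qed.

(** With p and r the square roots of D + O and D - O, take X and Y to be the block columns (p, r)
    and (p, -r) over sqrt 2: X^* X and Y^* Y give the half-sum D, X^* Y the half-difference O, and
    the cross terms cancel in X X^* + Y Y^*. *)
Lemma blk_star (R : realType) (C : cplx R) q : 0 < q -> blk C q -> star C q.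
Proof.
move=> q0 B n D O Dh Oh hP hQ.
have pq0 : (0 : R) `^ q = 0 by rewrite powR0 // gt_eqF.
pose p := hpow (D + O) (1 / 2); pose r := hpow (D - O) (1 / 2).
have pp : p *m p = D + O by rewrite /p hpow_half // hpow1.
have rr : r *m r = D - O by rewrite /r hpow_half // hpow1.
pose s := ofR C (Num.sqrt 2^-1).
have ss : s * s = 2^-1 :> C.
  by rewrite -rmorphM -expr2 sqr_sqrtr ?invr_ge0 // fmorphV rmorph_nat.
pose X : 'M[C]_(n + n) := s *: block_mx p 0 r 0.
pose Y : 'M[C]_(n + n) := s *: block_mx p 0 (- r) 0.
have tcs m (T : 'M[C]_m) : (s *: T) ^t* = s *: T ^t*.
  by apply/matrixP => i j; rewrite !mxE rmorphM /= ofR_conj.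
have half (T : 'M[C]_n) : (2^-1 : C) *: (T + T) = T.
  by apply/matrixP => i j; rewrite !mxE; field.
have eX : X ^t* *m X = block_mx D 0 0 0.
  rewrite /X tcs tc_block !tc0 !hpow_tc -scalemxAl -scalemxAr scalerA ss.
  rewrite mulmx_block !mul0mx !mulmx0 !addr0 pp rr scale_block_mx !scaler0.
  by rewrite addrACA subrr addr0 half.
have eY : Y ^t* *m Y = block_mx D 0 0 0.
  rewrite /Y tcs tc_block !tc0 tcN !hpow_tc -scalemxAl -scalemxAr scalerA ss.
  rewrite mulmx_block !mul0mx !mulmx0 !addr0 mulmxN mulNmx opprK pp rr.
  by rewrite scale_block_mx !scaler0 addrACA subrr addr0 half.
have eZ : X ^t* *m Y = block_mx O 0 0 0.
  rewrite /X /Y tcs tc_block !tc0 !hpow_tc -scalemxAl -scalemxAr scalerA ss.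
  rewrite mulmx_block !mul0mx !mulmx0 !addr0 mulmxN pp rr.
  by rewrite scale_block_mx !scaler0 opprB addrC addrA subrK half.
have eS : X *m X ^t* + Y *m Y ^t* = block_mx (D + O) 0 0 (D - O).
  rewrite /X /Y !tcs !tc_block !tc0 tcN !hpow_tc -!scalemxAl -!scalemxAr !scalerA ss.
  rewrite !mulmx_block !mul0mx ?mulmx0 !addr0 !mulmxN !mulNmx opprK pp rr.
  by rewrite -scalerDr add_block_mx !addrN scale_block_mx !scaler0 !half.
have := B _ X Y; rewrite -!trfun_gramC eX eY eZ eS.
have := herm_block 0 Oh (herm0 C n); rewrite tc0 => /hermP ->.
rewrite block0_sqr.
have OO : O *m O \is hermsymmx by rewrite -{2}(proj1 (hermP O) Oh) herm_gram.
have ph0 : (0 : R) `^ (q / 2) = 0 by rewrite powR0 // gt_eqF // divr_gt0.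
have [Ph Qh] : D + O \is hermsymmx /\ D - O \is hermsymmx.
  by case: hP; case: hQ.
rewrite (@trfun_block0 _ _ _ _ D (fun x => x `^ q)) //.
rewrite (@trfun_block0 _ _ _ _ (O *m O) (fun x => x `^ (q / 2))) //.
rewrite (@trfun_block _ _ _ _ (D + O) (D - O) _ Ph Qh) (trp_sqr q Oh).
by rewrite mulr_natl mulr2n => h; exact: h.
Qed.

(** * Doubling the exponent *)

Lemma dm_mulr (R : realType) (C : cplx R) m n (M : 'M[C]_(m, n)) a i j :
  (M *m dm C a) i j = M i j * ofR C (a j).
Proof. by rewrite /dm mul_mx_diag !mxE. Qed.

Lemma dm_mull (R : realType) (C : cplx R) m n (M : 'M[C]_(m, n)) a i j :
  (dm C a *m M) i j = ofR C (a i) * M i j.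
Proof. by rewrite /dm mul_diag_mx !mxE. Qed.

Lemma trp_sqr_psd (R : realType) (C : cplx R) n (P : 'M[C]_n) s : psd P ->
  trp s (P *m P) = trp (2 * s) P.
Proof.
case=> Ph P0; have e : 2 * s / 2 = s by field.
have := trp_sqr (2 * s) Ph; rewrite e => ->.
by apply: eq_bigr => i _; rewrite ger0_norm.
Qed.

Lemma eigen_sandwich (R : realType) (C : cplx R) n (E D : 'M[C]_n) o :
  E \is unitarymx ->
  E *m (D *m specmx E o) *m E ^t* = E *m D *m E ^t* *m dm C o.
Proof.
by move=> Eu; rewrite /specmx /dm -!mulmxA unitaryR // mulmx1.
Qed.

Lemma eigen_sandwich_l (R : realType) (C : cplx R) n (E D : 'M[C]_n) o :
  E \is unitarymx ->
  E *m (specmx E o *m D) *m E ^t* = dm C o *m (E *m D *m E ^t*).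
Proof.
by move=> Eu; rewrite /specmx /dm !mulmxA unitaryR // mul1mx.
Qed.

Lemma dgl_jordan (R : realType) (C : cplx R) n (E D : 'M[C]_n) o k :
  D \is hermsymmx -> E \is unitarymx ->
  dgl E (D *m specmx E o + specmx E o *m D) k = 2 * o k * dgl E D k.
Proof.
move=> Dh Eu; rewrite dglD {1 2}/dgl eigen_sandwich // eigen_sandwich_l //.
rewrite dm_mulr dm_mull (mulrC _ (ofR C (o k))) reRM.
by rewrite -mulrA mulr_natl mulr2n.
Qed.

(** The right side is the squared norm of row k of the product in the basis [E]; the left side keeps
    only its diagonal entry. *)
Lemma dgl_sandwich_sqr (R : realType) (C : cplx R) n (E D : 'M[C]_n) o k :
  D \is hermsymmx -> E \is unitarymx ->
  (o k * dgl E D k) ^+ 2 <=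
  dgl E (specmx E o *m D *m (specmx E o *m D) ^t*) k.
Proof.
move=> Dh Eu; rewrite dgl_gram.
have -> : \sum_j sqn ((E *m (specmx E o *m D)) k j) =
    \sum_j sqn ((E *m (specmx E o *m D) *m E ^t*) k j).
  set T := E *m _; have h (U : 'M[C]_n) : \sum_j sqn (U k j) =
      reR ((U *m U ^t*) k k).
    rewrite mxE reR_sum; apply: eq_bigr => j _.
    by rewrite !mxE mulrC -sqnE ofRK.
  by rewrite !h (tcM T) trmxCK mulmxA -(mulmxA T) unitaryC // mulmx1.
rewrite eigen_sandwich_l // (bigD1 k) //=.
have -> : (dm C o *m (E *m D *m E ^t*)) k k = ofR C (o k * dgl E D k).
  by rewrite dm_mull rmorphM dgl_ofR.
by rewrite sqnR lerDl sumr_ge0 // => j _; exact: sqn_ge0.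
Qed.

(** Here k = 2^s; the coefficients of t add up to 2 + 2 (k - 2) + (k - 2) k, which is exactly k^2 -
    2. *)
Lemma star_double_arith (R : realType) (k t d d2 o2 z r : R) :
  2 * d2 + (k - 2) * o2 <= r -> t + d + (k - 2) * z <= d2 ->
  (k - 2) * (k * t) <= (k - 2) * o2 -> (k - 2) * t <= (k - 2) * z ->
  2 * d + (k * k - 2) * t <= r.
Proof. nra. Qed.

Lemma star_double (R : realType) (C : cplx R) s : 2 <= s -> star C s ->
  star C (2 * s).
Proof.
move=> s2 S n D O Dh Oh hP hQ; have hD := star_psd Dh hP hQ.
have s0 : 0 <= s by lra.
have s1 : 1 <= s by lra.
have sh1 : 1 <= s / 2 by lra.
have sh0 : 0 <= s / 2 by lra.
have sp : 0 < s by lra.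
have B := star_blk sp S.
have k0 : 0 <= 2 `^ s - 2 :> R.
  by rewrite subr_ge0 -{1}(@powRr1 _ 2) // ler_powR ?ler1n.
have Dt := proj1 (hermP D) Dh; have Ot := proj1 (hermP O) Oh.
pose D2 := D *m D + O *m O; pose O2 := D *m O + O *m D.
pose E := spectralmx O; pose o := eigval O.
have Eu : E \is unitarymx by exact: spectral_unitarymx.
have eO : specmx E o = O by exact: specmx_eigval.
have D2h : D2 \is hermsymmx.
  by apply: hermD; rewrite -[X in _ *m X](proj1 (hermP _) _) ?herm_gram.
have O2h : O2 \is hermsymmx.
  by apply/hermP; rewrite /O2 tcD !tcM Dt Ot addrC.
have eP : D2 + O2 = (D + O) *m (D + O).
  have e (a b c d : 'M[C]_n) : a + b + (c + d) = a + c + (d + b).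
    by rewrite addrACA (addrC b).
  by rewrite mulmxDl !mulmxDr e.
have eQ : D2 - O2 = (D - O) *m (D - O).
  have e (a b c d : 'M[C]_n) : a + b - (c + d) = a - c - (d - b).
    by rewrite opprD opprB addrACA.
  by rewrite mulmxBl !mulmxBr e.
have psd2 (T : 'M[C]_n) : psd T -> psd (T *m T).
  by case=> Th _; rewrite -{2}(proj1 (hermP T) Th); apply: psd_gram.
have := S _ D2 O2 D2h O2h; rewrite eP eQ => /(_ (psd2 _ hP) (psd2 _ hQ)).
rewrite (trp_sqr_psd s hP) (trp_sqr_psd s hQ) => h1.
have := B n O D; rewrite Ot Dt (addrC (O *m O)) -/D2 => h2.
set tau := trfun (fun x => `|x| `^ (2 * s)) O.
have e2 : 2 * s / 2 = s by field.
have tO : trp s (O *m O) = tau.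
  by have := trp_sqr (2 * s) Oh; rewrite e2.
have ok k : (o k ^+ 2) `^ s = `|o k| `^ (2 * s).
  by rewrite -powR_sqr_half e2.
have od k : `|o k| <= dgl E D k.
  by have := star_dgl E k hP hQ; rewrite -{1}eO dgl_eig.
(* In the eigenbasis of O the diagonal of D O + O D is 2 o_k D_kk, and D_kk >= |o_k|. *)
have h3 : 2 `^ s * tau <= trfun (fun x => `|x| `^ s) O2.
  apply: le_trans (_ : _ <= \sum_k `|dgl E O2 k| `^ s) _; last first.
    exact: peierls_norm.
  rewrite mulr_sumr; apply: ler_sum => k _.
  rewrite -/o -ok /O2 -eO dgl_jordan // -powRM ?sqr_ge0 //.
  rewrite ge0_ler_powR ?nnegrE //.
    by rewrite mulr_ge0 // sqr_ge0.
  rewrite !normrM (ger0_norm (ler0n _ 2)) (ger0_norm (dgl_ge0 _ _ hD)).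
  by rewrite -mulrA ler_wpM2l // -real_normK ?num_real // expr2 ler_wpM2l.
(* The diagonal of O D D O is at least (o_k D_kk)^2 >= o_k^4. Peierls at the exponent s / 2 is where
   s >= 2 enters. *)
have h4 : tau <= trp (s / 2) (O *m D *m (O *m D) ^t*).
  apply: le_trans (_ : _ <= \sum_k dgl E (O *m D *m (O *m D) ^t*) k `^ (s / 2)) _.
    apply: ler_sum => k _; rewrite -/o -ok.
    have -> : (o k ^+ 2) `^ s = (o k ^+ 2 ^+ 2) `^ (s / 2).
      by rewrite powR_sqr_half ger0_norm // sqr_ge0.
    rewrite ge0_ler_powR ?nnegrE ?sqr_ge0 //.
      exact: dgl_ge0 (psd_gram _).
    apply: le_trans (_ : (o k * dgl E D k) ^+ 2 <= _); last first.
      by rewrite -eO dgl_sandwich_sqr.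
    rewrite [leRHS]exprMn [leLHS]expr2 ler_wpM2l ?sqr_ge0 //.
    rewrite -[leLHS]real_normK ?num_real // lerXn2r ?nnegrE //.
    exact: dgl_ge0.
  by apply: peierls_ge1 => //; exact: psd_gram.
have e4 : 2 `^ (2 * s) = 2 `^ s * 2 `^ s :> R.
  have -> : 2 * s = s + s by ring.
  by rewrite powRD // pnatr_eq0 implybT.
rewrite (trp_sqr_psd s hD) tO in h2.
rewrite e4; exact: star_double_arith h1 h2 (ler_wpM2l k0 h3) (ler_wpM2l k0 h4).
Qed.

(** * Exponents between 2 and 3 *)

(** Tangents at a bound (a + b)^r and b^r from below; with the weights a - b and b their first-order
    terms cancel. *)
Lemma powR_diff_le (R : realType) (a b r : R) : 0 < b -> b <= a -> 1 <= r ->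
  a `^ (r + 1) - b `^ (r + 1) <= (a + b) `^ r * (a - b).
Proof.
move=> b0 ba r1; have a0 : 0 < a by exact: lt_le_trans ba.
have r0 : 0 < r by lra.
have e (x : R) : 0 < x -> x `^ (r + 1) = x * x `^ r.
  by move=> x0; rewrite powRD ?(gt_eqF x0) ?implybT // powRr1 ?(ltW x0) // mulrC.
have er : a * a `^ (r - 1) = a `^ r by rewrite mulr_powRB1 // ltW.
have h1 := powR_tangent_ge1 r1 (ltW (addr_gt0 a0 b0)) (ltW a0).
have h2 := powR_tangent_ge1 r1 (ltW b0) (ltW a0).
rewrite !e //; rewrite -er in h1 h2 *.
have := ler_wpM2r (_ : 0 <= a - b) h1; rewrite subr_ge0 => /(_ ba) {}h1.
have := ler_wpM2l (ltW b0) h2; move: h1 {h2}.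
move: (a `^ (r - 1)) ((a + b) `^ r) (b `^ r) => x y z; nra.
Qed.

Lemma is_derive_expR_scale (R : realType) (u t : R) :
  is_derive t 1 (fun t => expR (t * u)) (expR (t * u) * u).
Proof.
have d : is_derive t 1 (fun t : R => t * u) u.
  by have := is_derive_affine 0 u t; under eq_fun do rewrite add0r.
exact: (@is_derive1_comp _ expR (fun t => t * u) t _ _ (is_derive_expR _) d).
Qed.

(** Replacing u by t u, the right side is 2^q - 2 at t = 0. With a = e^(t u) and b = e^(-t u) its
    derivative is q u ((a + b)^(q-1) (a - b) - (a^q - b^q)), nonnegative by [powR_diff_le]. *)
Lemma cosh_powR_ge (R : realType) (u q : R) : 0 <= u -> 2 <= q ->
  2 `^ q - 2 <= (expR u + expR (- u)) `^ q - expR u `^ q - expR (- u) `^ q.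
Proof.
move=> u0 q2.
pose g t := expR (t * u) + expR (t * - u).
pose F t := g t `^ q + (-1 * expR (t * (q * u)) + -1 * expR (t * - (q * u))).
pose dF t := q * g t `^ (q - 1) * (expR (t * u) * u + expR (t * - u) * - u) +
  (-1 * (expR (t * (q * u)) * (q * u)) + -1 * (expR (t * - (q * u)) * - (q * u))).
have hF (t : R) : 0 <= t <= 1 -> is_derive t 1 F (dF t).
  move=> _; apply: is_derive_addf; last first.
    by apply: is_derive_addf; apply: is_derive_scale; apply: is_derive_expR_scale.
  have g0 : 0 < g t by rewrite addr_gt0 ?expR_gt0.
  have dg : is_derive t 1 g (expR (t * u) * u + expR (t * - u) * - u).
    by apply: is_derive_addf; apply: is_derive_expR_scale.
  exact: (@is_derive1_comp _ (@powR R ^~ q) g t _ _ (is_derive1_powR q g0) dg).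
have dF0 (t : R) : 0 <= t <= 1 -> 0 <= dF t.
  move=> /andP[t0 t1]; set a := expR (t * u); set b := expR (t * - u).
  have ba : b <= a by rewrite ler_expR ler_wpM2l //; lra.
  have eq1 : q = (q - 1) + 1 by ring.
  have pa v : expR (t * (q * v)) = expR (t * v) `^ (q - 1 + 1).
    by rewrite -eq1 -expRM; congr expR; ring.
  have r1 : 1 <= q - 1 by lra.
  have := powR_diff_le (expR_gt0 _) ba r1; rewrite -/b.
  have qu : 0 <= q * u by rewrite mulr_ge0 //; lra.
  rewrite -subr_ge0 => /(mulr_ge0 qu).
  rewrite /dF /g -/a -/b -mulrN !pa -/a -/b mulrN.
  by congr (_ <= _); ring.
have := ge0_derive01 hF dF0 (_ : 0 <= (1 : R) <= 1); rewrite lexx ler01.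
move=> /(_ isT); rewrite /F /g !mul0r !mul1r expR0 -mulrN !(mulrC q) !expRM.
by congr (_ <= _); ring.
Qed.

(** Dividing by the geometric mean [g] reduces positive a, b to e^u, e^(-u). *)
Lemma scalar_blk (R : realType) (a b q : R) : 0 <= a -> 0 <= b -> 2 <= q ->
  a `^ q + b `^ q + (2 `^ q - 2) * (a * b) `^ (q / 2) <= (a + b) `^ q.
Proof.
have q0 : 2 <= q -> q != 0 by move=> q2; rewrite gt_eqF //; lra.
wlog ba : a b / b <= a.
  move=> H a0 b0 q2; have [ba|/ltW ab] := leP b a; first exact: H.
  by have := H b a ab b0 a0 q2; rewrite (addrC b a) (mulrC b) (addrC (b `^ q)).
rewrite le_eqVlt => /predU1P[a0|a0].
  rewrite -a0 in ba *; move=> b0 q2.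
  have -> : b = 0 by apply/eqP; rewrite eq_le ba.
  by rewrite mulr0 addr0 !powR0 ?q0 // ?addr0 ?mulr0 ?addr0 // gt_eqF //; lra.
rewrite le_eqVlt => /predU1P[<- q2|b0 q2].
  rewrite mulr0 (powR0 (q0 q2)) powR0 ?mulr0 ?addr0 //.
  by rewrite gt_eqF //; lra.
pose g := expR ((ln a + ln b) / 2); pose u := (ln a - ln b) / 2.
have ea : a = g * expR u by rewrite -expRD -{1}(lnK a0); rewrite /u; congr expR; field.
have eb : b = g * expR (- u).
  by rewrite -expRD -{1}(lnK b0); rewrite /u; congr expR; field.
have g0 : 0 <= g by exact: expR_ge0.
have u0 : 0 <= u by rewrite divr_ge0 // subr_ge0 ler_ln.
have gab : (a * b) `^ (q / 2) = g `^ q.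
  have -> : a * b = g ^+ 2.
    by rewrite ea eb mulrACA (expRxMexpNx_1 u) mulr1 expr2.
  by rewrite powR_sqr_half ger0_norm.
rewrite gab ea eb -mulrDr !powRM ?addr_ge0 ?expR_ge0 //.
have := ler_wpM2l (powR_ge0 g q) (cosh_powR_ge u0 q2); lra.
Qed.

(** Written as A - (-B), the sum S has matrix elements <u_i|w_j> (a_i + b_j), which provides two of
    the q powers. Hansen's inequality with h = q - 2 handles the others, since in the eigenbasis of
    S the diagonal of A + B is its spectrum. *)
Lemma blk_classical (R : realType) (C : cplx R) n (U W : 'M[C]_n)
    (a b : 'I_n -> R) q :
  U \is unitarymx -> W \is unitarymx ->
  (forall i, 0 <= a i) -> (forall i, 0 <= b i) -> 2 <= q <= 3 ->
  \sum_i \sum_j sqn ((U *m W ^t*) i j) * (a i + b j) `^ q <=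
  trp q (specmx U a + specmx W b).
Proof.
move=> Uu Wu a0 b0 /andP[q2 q3].
have hA : psd (specmx U a) by exact: psd_specmx.
have hB : psd (specmx W b) by exact: psd_specmx.
have [Sh s0] := psdD hA hB; set S := specmx U a + specmx W b in Sh s0 *.
pose E := spectralmx S; pose s := eigval S.
have Eu : E \is unitarymx by exact: spectral_unitarymx.
have eS : specmx E s = S by exact: specmx_eigval.
have sq (x : R) : 0 <= x -> x ^+ 2 * x `^ (q - 2) = x `^ q.
  move=> x0; rewrite -powR_mulrn // -powRDge //; last by lra.
  by congr (_ `^ _); ring.
have eN : specmx W (fun j => - b j) = - specmx W b.
  apply/matrixP => i j; rewrite [RHS]mxE !specmx_entry -sumrN.
  by apply: eq_bigr => k _; rewrite rmorphN mulrN mulNr.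
have h01 : 0 <= q - 2 <= 1 by apply/andP; split; lra.
have := @pair_powR_le _ C n E U W s a b 1 1 (q - 2) Eu Uu Wu a0 b0 ler01 ler01 h01.
congr (_ <= _).
  apply: eq_bigr => i _; apply: eq_bigr => j _.
  have -> : specmx E s = specmx U a - specmx W (fun j => - b j).
    by rewrite eN opprK eS.
  by rewrite specmx_diff // opprK !mul1r -mulrA sq // addr_ge0.
by apply: eq_bigr => k _; rewrite !mul1r -dglD -/S -{1}eS dgl_eig // sq.
Qed.

(* Schur triangularisation: the diagonal of V M V^* lists the eigenvalues, here
   nonnegative since shared with H. *)
Lemma schur_psd (R : realType) (C : cplx R) n (M H : 'M[C]_n) : psd H ->
  char_poly M = char_poly H ->
  exists V : 'M[C]_n, [/\ V \is unitarymx, forall k, 0 <= dgl V M k &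
    forall f, trfun f H = \sum_k f (dgl V M k)].
Proof.
case: n M H => [|n] M H [Hh H0] MH.
  exists 1%:M; split; rewrite ?unitary1 //; try by case.
  by move=> f; rewrite /trfun !big_ord0.
have [V Vu VT] := Schur M (ltn0Sn n).
have {}VT : is_trig_mx (V *m M *m V ^t*) by rewrite -conjymx.
exists V.
have cp : char_poly (V *m M *m V ^t*) = char_poly H.
  by rewrite -mulmxA char_poly_mulC -mulmxA unitaryC // mulmx1.
have pe : perm_eq [seq (V *m M *m V ^t*) k k | k : 'I_n.+1]
    [seq ofR C (eigval H k) | k : 'I_n.+1].
  apply: prod_XsubC_eq; rewrite !big_image /= -char_poly_trig // cp.
  by rewrite -{1}(specmx_eigval Hh) char_poly_specmx ?spectral_unitarymx.
have hk k : exists i, (V *m M *m V ^t*) k k = ofR C (eigval H i).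
  have : (V *m M *m V ^t*) k k \in [seq ofR C (eigval H k) | k : 'I_n.+1].
    rewrite -(perm_mem pe); apply/mapP; exists k => //; exact: mem_enum.
  by case/mapP => i _ ->; exists i.
split=> // [k|f].
  by rewrite /dgl; have [i ->] := hk k; rewrite ofRK.
transitivity (\sum_(z <- [seq ofR C (eigval H k) | k : 'I_n.+1]) f (reR z)).
  by rewrite big_image; apply: eq_bigr => k _; rewrite ofRK.
by rewrite -(perm_big _ pe) big_image.
Qed.

(** * The Araki-Lieb-Thirring inequality *)

Lemma dgl_cauchy_schwarz (R : realType) (C : cplx R) n (V X Y : 'M[C]_n) k :
  dgl V (X ^t* *m Y) k ^+ 2 <= dgl V (X ^t* *m X) k * dgl V (Y ^t* *m Y) k.
Proof.
pose x := col k (X *m V ^t*); pose y := col k (Y *m V ^t*).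
have e (Z T : 'M[C]_n) : (col k (Z *m V ^t*)) ^t* *m col k (T *m V ^t*) =
    ((V *m (Z ^t* *m T) *m V ^t*) k k)%:M.
  rewrite [LHS]mx11_scalar; congr (_ %:M).
  rewrite -[in RHS](trmxCK V) !mulmxA -tcM -mulmxA !mxE; apply: eq_bigr => i _.
  by rewrite trmxCK !mxE.
have ww (Z : 'M[C]_n) : wnorm (fun=> 1) (col k (Z *m V ^t*)) = dgl V (Z ^t* *m Z) k.
  apply: (@ofR_inj _ C); rewrite wnormE dm1 mulmx1 e dgl_ofR ?mxE ?mulr1n //.
  by apply/hermP; rewrite tcM trmxCK.
by have := cauchy_schwarz x y; rewrite !ww e mxE mulr1n.
Qed.

Lemma tr_specmxM (R : realType) (C : cplx R) n (U W : 'M[C]_n) c d :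
  \tr (specmx U c *m specmx W d) =
  ofR C (\sum_i \sum_j sqn ((U *m W ^t*) i j) * (c i * d j)).
Proof.
set P := U *m W ^t*.
have -> : \tr (specmx U c *m specmx W d) = \tr (dm C c *m P *m dm C d *m P ^t*).
  by rewrite /specmx -!mulmxA mxtrace_mulC /P tcM trmxCK !mulmxA.
rewrite /mxtrace rmorph_sum; apply: eq_bigr => i _.
rewrite mxE rmorph_sum; apply: eq_bigr => j _.
rewrite dm_mulr dm_mull !mxE -/(P) -[in RHS]sqn_conj !rmorphM sqnE conjCK /=.
by ring.
Qed.

Lemma tr_psd (R : realType) (C : cplx R) n (A : 'M[C]_n) : psd A ->
  \tr A = ofR C (trp 1 A).
Proof.
case=> Ah A0; rewrite -{1}(specmx_eigval Ah) tr_specmx ?spectral_unitarymx //.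
by congr (ofR C _); apply: eq_bigr => i _; rewrite powRr1.
Qed.

Lemma psd_gramC (R : realType) (C : cplx R) m n (X : 'M[C]_(m, n)) :
  psd (X ^t* *m X).
Proof. by rewrite -{2}[X]trmxCK; apply: psd_gram. Qed.

(* Splitting s as the midpoint of t and an endpoint of [1/2, 1] shrinks any bound
   c on F - F 1 to 2 c / 3. *)
Lemma midpoint_le (R : realType) (F : R -> R) c :
  (forall s t, 0 < s -> s <= 1 -> 0 < t -> t <= 1 ->
     (s + t) * F ((s + t) / 2) <= s * F s + t * F t) ->
  F 2^-1 <= F 1 -> 0 <= F 1 -> 0 <= c ->
  (forall s, 2^-1 <= s -> s <= 1 -> F s <= c) ->
  forall s, 2^-1 <= s -> s <= 1 -> F s <= F 1.
Proof.
move=> mid half F10 c0 hc.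
have step c' : 0 <= c' -> (forall s, 2^-1 <= s -> s <= 1 -> F s <= F 1 + c') ->
    forall s, 2^-1 <= s -> s <= 1 -> F s <= F 1 + c' * (2 / 3).
  move=> c'0 h s s2 s1; have s0 : 0 < s by lra.
  rewrite -(ler_pM2l s0).
  (* The error is multiplied by t / (2 s): this is 1 - 1/(4 s) <= 2/3 with the endpoint 1/2 when s
     <= 3/4, and 1 - 1/(2 s) <= 1/2 with the endpoint 1. *)
  have [s3|s3] := leP s (3 / 4).
    have t2 : 2^-1 <= s * 2 - 2^-1 by lra.
    have t1 : s * 2 - 2^-1 <= 1 by lra.
    have t0 : 0 <= s * 2 - 2^-1 by lra.
    have k := @mid 2^-1 (s * 2 - 2^-1) ltac:(lra) ltac:(lra) ltac:(lra) t1.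
    have e : (2^-1 + (s * 2 - 2^-1)) / 2 = s by field.
    have m := ler_wpM2l t0 (h _ t2 t1).
    have cc : 0 <= (3 / 4 - s) * c' by rewrite mulr_ge0 //; lra.
    rewrite e in k; move: k m cc half; clear -R.
    move: (F s) (F 1) (F _) (F _) => x y z u; lra.
  have t2 : 2^-1 <= s * 2 - 1 by lra.
  have t1 : s * 2 - 1 <= 1 by lra.
  have t0 : 0 <= s * 2 - 1 by lra.
  have k := @mid (s * 2 - 1) 1 ltac:(lra) ltac:(lra) ltac:(lra) ltac:(lra).
  have e : (s * 2 - 1 + 1) / 2 = s by field.
  have m := ler_wpM2l t0 (h _ t2 t1).
  have cc : 0 <= (3 / 2 - s) * c' by rewrite mulr_ge0 //; lra.
  rewrite e in k; move: k m cc half; clear -R.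
  move: (F s) (F 1) (F _) (F _) => x y z u; lra.
move=> s s2 s1; apply: (@le_of_contraction _ _ _ c (2 / 3)) => // [|k].
  by apply/andP; split; lra.
elim: k s s2 s1 => [|k IH] s s2 s1.
  by rewrite expr0 mulr1; apply: le_trans (hc _ s2 s1) _; rewrite lerDr.
rewrite exprSr mulrA; apply: step => //.
by rewrite mulr_ge0 // exprn_ge0 //; lra.
Qed.

(* The typical case is Ap s = A^s, Bp s = B^s.  In mid_step, the eigenvalues of
   H ((s + t) / 2) are those of (Y s)^* (Y t), whose diagonal entries in a Schur basis
   are controlled by those of H s and H t. *)
Section SemigroupPair.
Variables (R : realType) (C : cplx R) (n : nat) (Ap Bp : R -> 'M[C]_n).
Hypotheses (ApH : forall s, (Ap s) ^t* = Ap s) (BpH : forall s, (Bp s) ^t* = Bp s).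
Hypothesis ApM : forall s t : R, 0 <= s -> 0 <= t -> Ap s *m Ap t = Ap (s + t).
Hypothesis BpM : forall s t : R, 0 <= s -> 0 <= t -> Bp s *m Bp t = Bp (s + t).

Let Y s := Ap (s / 2) *m Bp (s / 2).
Let H s := (Y s) ^t* *m Y s.
Let F s := trp s^-1 (H s).

Let YtcE s : (Y s) ^t* = Bp (s / 2) *m Ap (s / 2).
Proof. by rewrite tcM ApH BpH. Qed.

Let char_Y (s t : R) : 0 < s -> 0 < t ->
  char_poly ((Y s) ^t* *m Y t) = char_poly (Ap ((s + t) / 2) *m Bp ((s + t) / 2)).
Proof.
move=> s0 t0; have s2 : 0 <= s / 2 by lra.
have t2 : 0 <= t / 2 by lra.
rewrite YtcE -mulmxA char_poly_mulC /Y !mulmxA ApM // -mulmxA BpM //.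
by rewrite mulrDl [t / 2 + _]addrC.
Qed.

Let char_H (s : R) : 0 < s -> char_poly (H s) = char_poly (Ap s *m Bp s).
Proof.
by move=> s0; rewrite char_Y // (_ : (s + s) / 2 = s) //; field.
Qed.

Let mid_step (s t : R) : 0 < s <= 1 -> 0 < t <= 1 ->
  (s + t) * F ((s + t) / 2) <= s * F s + t * F t.
Proof.
move=> /andP[s0 s1] /andP[t0 t1].
have st0 : 0 < s + t by lra.
have st1 : 0 < (s + t) / 2 by lra.
have [V [Vu m0 trV]] := schur_psd (psd_gramC (Y ((s + t) / 2)))
  (etrans (char_Y s0 t0) (esym (char_H st1))).
rewrite /F trV.
have p1 (u : R) : 0 < u <= 1 -> 1 <= u^-1 by case/andP=> u0 u1; rewrite invf_ge1.
have hs := peierls_ge1 (psd_gramC (Y s)) Vu (p1 s (introT andP (conj s0 s1))).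
have ht := peierls_ge1 (psd_gramC (Y t)) Vu (p1 t (introT andP (conj t0 t1))).
apply: le_trans (lerD (ler_wpM2l (ltW s0) hs) (ler_wpM2l (ltW t0) ht)).
rewrite !mulr_sumr -big_split; apply: ler_sum => k _ /=.
have := dgl_cauchy_schwarz V (Y s) (Y t) k; have := m0 k.
have := dgl_ge0 V k (psd_gramC (Y s)); have := dgl_ge0 V k (psd_gramC (Y t)).
move: (dgl _ _ _) (dgl _ _ _) (dgl _ _ _) => m x y y0 x0 mk h.
have e1 : m `^ ((s + t) / 2)^-1 = (m ^+ 2) `^ (s + t)^-1.
  rewrite -powR_mulrn // -powRrM; congr (_ `^ _).
  by field; rewrite gt_eqF.
have h0 : 0 <= s / (s + t) by rewrite divr_ge0 // ltW.
have h1 : s / (s + t) <= 1 by rewrite ler_pdivrMr // mul1r lerDl ltW.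
(* Young with weights s/(s+t) and t/(s+t) on x^(1/s) and y^(1/t), whose product is (x y)^(1/(s+t)),
   a bound for m^(2/(s+t)). *)
have := young_powR (powR_ge0 x s^-1) (powR_ge0 y t^-1) h0 h1.
rewrite -!powRrM; have -> : s^-1 * (s / (s + t)) = (s + t)^-1.
  by field; rewrite !gt_eqF.
have -> : t^-1 * (1 - s / (s + t)) = (s + t)^-1.
  by field; rewrite !gt_eqF.
rewrite -powRM // => h2.
have h3 : m `^ ((s + t) / 2)^-1 <=
    s / (s + t) * x `^ s^-1 + (1 - s / (s + t)) * y `^ t^-1.
  rewrite e1; apply: le_trans h2; apply: ge0_ler_powR => //.
  - by rewrite invr_ge0 ltW.
  - by rewrite nnegrE sqr_ge0.
  - by rewrite nnegrE mulr_ge0.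
have := ler_wpM2l (ltW st0) h3; congr (_ <= _).
by field; rewrite gt_eqF.
Qed.

(** H (1/2) has the eigenvalues of Y 1, so this is Schur's bound of the sum of their squares by Tr
    (Y Y^H), with Y = Y 1 and Y^H its adjoint. *)
Let F_half : F (2^-1) <= F 1.
Proof.
have h2 : 0 < 2^-1 :> R by rewrite invr_gt0.
have cY : char_poly (Y 1) = char_poly (H 2^-1).
  by rewrite char_H // /Y mul1r.
have [V [Vu m0 trV]] := schur_psd (psd_gramC (Y 2^-1)) cY.
rewrite /F trV invrK invr1.
have -> : trp 1 (H 1) = trp 1 (Y 1 *m (Y 1) ^t*) by exact: trfun_gramC.
apply: le_trans (peierls_ge1 (psd_gram (Y 1)) Vu (lexx 1)).
apply: ler_sum => k _; rewrite powRr1 ?dgl_ge0 //; last exact: psd_gram.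
rewrite powR_mulrn //; have := dgl_cauchy_schwarz V ((Y 1) ^t*) 1%:M k.
by rewrite trmxCK mulmx1 tc1 mulmx1 -(specmx1 Vu) dgl_eig // mulr1.
Qed.

Let tr_H (s : R) : 0 < s -> \tr (H s) = \tr (Ap s *m Bp s).
Proof.
move=> s0; have s2 : 0 <= s / 2 by lra.
rewrite /H YtcE -mulmxA mxtrace_mulC /Y !mulmxA ApM // -mulmxA BpM //.
by rewrite -splitr.
Qed.

Let F1 : ofR C (F 1) = \tr (Ap 1 *m Bp 1).
Proof. by rewrite /F invr1 -tr_psd ?tr_H //; apply: psd_gramC. Qed.

(** Only a starting bound for [midpoint_le]: each eigenvalue is at most the trace, and the exponent
    1/s is at most 2. *)
Let F_bound (T : R) : 0 <= T ->
  (forall s, 1 / 2 <= s <= 1 -> \tr (Ap s *m Bp s) <= ofR C T) ->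
  forall s, 1 / 2 <= s <= 1 -> F s <= \sum_(i < n) (1 + T) ^+ 2.
Proof.
move=> T0 hT s /andP[s2 s1].
have s0 : 0 < s by lra.
have [Hh H0] : psd (H s) by exact: psd_gramC.
have trT : \sum_i eigval (H s) i <= T.
  rewrite -(ofR_le C) -(tr_specmx (eigval (H s)) (spectral_unitarymx (H s))).
  by rewrite specmx_eigval // tr_H //; apply: hT; rewrite s2.
apply: ler_sum => i _; have li : eigval (H s) i <= T.
  apply: le_trans trT; rewrite (bigD1 i) //= lerDl.
  by apply: sumr_ge0 => j _; apply: H0.
have si1 : 1 <= s^-1 by rewrite invf_ge1.
have si2 : s^-1 <= 2 by rewrite -[2]invrK lef_pV2 ?posrE ?invr_gt0 //; lra.
apply: (@le_trans _ _ ((1 + T) `^ s^-1)).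
  apply: ge0_ler_powR; rewrite ?nnegrE ?invr_ge0 ?H0 //; first exact: ltW.
  - by rewrite addr_ge0.
  - by apply: le_trans li _; rewrite lerDr.
by rewrite -powR_mulrn ?addr_ge0 //; apply: ler_powR => //; rewrite lerDl.
Qed.

Lemma semigroup_trp_le (T s : R) : 0 <= T ->
  (forall t, 1 / 2 <= t <= 1 -> \tr (Ap t *m Bp t) <= ofR C T) ->
  1 / 2 <= s <= 1 ->
  exists2 K : 'M[C]_n,
    K \is hermsymmx /\ char_poly K = char_poly (Ap s *m Bp s) &
    ofR C (trp s^-1 K) <= \tr (Ap 1 *m Bp 1).
Proof.
move=> T0 hT hs; exists (H s).
  by split; [case: (psd_gramC (Y s)) | apply: char_H; case/andP: hs => *; lra].
rewrite -F1 ofR_le; set c := \sum_(i < n) (1 + T) ^+ 2.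
have c0 : 0 <= c by apply: sumr_ge0 => i _; rewrite sqr_ge0.
have F10 : 0 <= F 1 by apply: trfun_ge0 => x; apply: powR_ge0.
move: hs; rewrite div1r => /andP[s2 s1].
apply: (@midpoint_le _ F c _ F_half F10 c0 _ s s2 s1).
  by move=> x y x0 x1 y0 y1; apply: mid_step; rewrite ?x0 ?y0.
move=> x x2 x1; apply: F_bound => //.
by rewrite div1r x2.
Qed.
End SemigroupPair.

(** Apply the semigroup bound to A^(r s) and B^(r s): s = 1/r, in [1/2,1], gives the product A B,
    and s = 1 gives Tr A^r B^r, the right side. *)
Lemma araki_lieb_thirring (R : realType) (C : cplx R) n (U W H : 'M[C]_n) a b r :
  U \is unitarymx -> W \is unitarymx ->
  (forall i, 0 <= a i) -> (forall i, 0 <= b i) -> 1 <= r <= 2 ->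
  H \is hermsymmx -> char_poly H = char_poly (specmx U a *m specmx W b) ->
  trp r H <= \sum_i \sum_j sqn ((U *m W ^t*) i j) * (a i * b j) `^ r.
Proof.
move=> Uu Wu a0 b0 /andP[r1 r2] Hh cH.
have r0 : 0 < r by lra.
pose Ap s := specmx U (fun i => (a i `^ r) `^ s).
pose Bp s := specmx W (fun i => (b i `^ r) `^ s).
have rr x : 0 <= x -> (x `^ r) `^ r^-1 = x.
  by move=> x0; rewrite -powRrM divff ?gt_eqF // powRr1.
have eA : Ap r^-1 = specmx U a by apply: eq_specmx => i; apply: rr.
have eB : Bp r^-1 = specmx W b by apply: eq_specmx => i; apply: rr.
have hr : 1 / 2 <= r^-1 <= 1.
  by rewrite div1r lef_pV2 ?posrE // r2 invf_le1.
have spM (V : 'M[C]_n) (c : 'I_n -> R) s t : V \is unitarymx -> 0 <= s -> 0 <= t ->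
    specmx V (fun i => (c i `^ r) `^ s) *m specmx V (fun i => (c i `^ r) `^ t) =
    specmx V (fun i => (c i `^ r) `^ (s + t)).
  by move=> Vu s0 t0; rewrite specmx_mul //; apply: eq_specmx => i; rewrite powRDge.
pose T := \sum_i \sum_j sqn ((U *m W ^t*) i j) * ((1 + a i `^ r) * (1 + b j `^ r)).
have pw (s x : R) : 1 / 2 <= s <= 1 -> 0 <= x -> x `^ s <= 1 + x.
  move=> /andP[s2 s1] x0; have s0 : 0 <= s by lra.
  have := young_powR x0 ler01 s0 s1.
  rewrite powR1 !mulr1 => h; apply: le_trans h _.
  have := ler_wpM2r x0 s1; rewrite mul1r; lra.
have T0 : 0 <= T.
  apply: sumr_ge0 => i _; apply: sumr_ge0 => j _.
  by rewrite mulr_ge0 ?sqn_ge0 // mulr_ge0 // addr_ge0 ?powR_ge0.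
have hT s : 1 / 2 <= s <= 1 -> \tr (Ap s *m Bp s) <= ofR C T.
  move=> hs; rewrite tr_specmxM ofR_le.
  apply: ler_sum => i _; apply: ler_sum => j _; apply: ler_wpM2l.
    exact: sqn_ge0.
  by apply: ler_pM; rewrite ?powR_ge0 // pw ?powR_ge0.
have [K [Kh cK]] := @semigroup_trp_le R C n Ap Bp
  (fun s => (hermP _).1 (specmx_herm _ _)) (fun s => (hermP _).1 (specmx_herm _ _))
  (fun s t => spM U a s t Uu) (fun s t => spM W b s t Wu) T r^-1 T0 hT hr.
have cKH : char_poly K = char_poly H.
  by rewrite cK cH eA eB; reflexivity.
rewrite invrK tr_specmxM ofR_le (trfun_char (fun x => x `^ r) Kh Hh cKH).
congr (_ <= _); apply: eq_bigr => i _; apply: eq_bigr => j _.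
by rewrite !powRr1 ?powR_ge0 // powRM.
Qed.

Lemma blk_23 (R : realType) (C : cplx R) q : 2 <= q <= 3 -> blk C q.
Proof.
move=> /andP[q2 q3] n X Y.
have [Ah A0] := psd_gram X; have [Bh B0] := psd_gram Y.
set U := spectralmx (X *m X ^t*); set W := spectralmx (Y *m Y ^t*).
have Uu : U \is unitarymx by exact: spectral_unitarymx.
have Wu : W \is unitarymx by exact: spectral_unitarymx.
set a := eigval (X *m X ^t*) in A0; set b := eigval (Y *m Y ^t*) in B0.
have eA : specmx U a = X *m X ^t* by exact: specmx_eigval.
have eB : specmx W b = Y *m Y ^t* by exact: specmx_eigval.
have q23 : 2 <= q <= 3 by rewrite q2.
have := blk_classical Uu Wu A0 B0 q23; rewrite eA eB; apply: le_trans.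
have r12 : 1 <= q / 2 <= 2 by apply/andP; split; lra.
have cZ : char_poly (X ^t* *m Y *m (X ^t* *m Y) ^t*) =
    char_poly (specmx U a *m specmx W b).
  by rewrite eA eB tcM trmxCK -mulmxA char_poly_mulC [RHS]char_poly_mulC !mulmxA.
have k0 : 0 <= 2 `^ q - 2.
  rewrite subr_ge0 -[leLHS]powRr1 //; apply: ler_powR; first by rewrite ler1n.
  by lra.
have alt := araki_lieb_thirring Uu Wu A0 B0 r12 (herm_gram (X ^t* *m Y)) cZ.
apply: le_trans (lerD (lexx _) (ler_wpM2l k0 alt)) _.
have -> : trp q (X *m X ^t*) =
    \sum_i \sum_j sqn ((U *m W ^t*) i j) * a i `^ q.
  apply: eq_bigr => i _.
  by rewrite -mulr_suml unitary_row ?mul1r // unitaryM_tc.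
have -> : trp q (Y *m Y ^t*) =
    \sum_i \sum_j sqn ((U *m W ^t*) i j) * b j `^ q.
  rewrite exchange_big; apply: eq_bigr => j _ /=.
  by rewrite -mulr_suml unitary_col ?mul1r // unitaryM_tc.
rewrite mulr_sumr -!big_split; apply: ler_sum => i _ /=.
rewrite mulr_sumr -!big_split; apply: ler_sum => j _ /=.
rewrite mulrCA -!mulrDr; apply: ler_wpM2l; first exact: sqn_ge0.
exact: scalar_blk.
Qed.

Lemma blk_ge2 (R : realType) (C : cplx R) q : 2 <= q -> blk C q.
Proof.
move=> q2; apply: star_blk; first by lra.
have [k] : exists k, q <= 2 + k%:R.
  exists (Num.bound q).
  by apply: le_trans (ltW (archi_boundP (le_trans (ler0n R 2) q2))) _; rewrite lerDr.
elim: k q q2 => [|k IH] q q2 qk.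
  rewrite addr0 in qk; apply: blk_star; first by lra.
  by apply: blk_23; rewrite q2 (le_trans qk) // ler_nat.
have [q3|q3] := leP q 3.
  by apply: blk_star; [lra | apply: blk_23; rewrite q2].
have [q4|q4] := leP q 4; first by apply: star_34; rewrite ltW.
(* Here 4 < q <= 3 + k, hence 2 < q / 2 <= 2 + k and the induction hypothesis applies to q / 2. *)
have -> : q = 2 * (q / 2) by field.
have k0 : 0 <= k%:R :> R by rewrite ler0n.
by apply: star_double; [lra | apply: IH; move: qk; rewrite -[k.+1%:R]natr1; lra].
Qed.

(** * Negative exponents *)

Lemma det_specmx (R : realType) (C : cplx R) n (U : 'M[C]_n) a :
  U \is unitarymx -> \det (specmx U a) = \prod_i ofR C (a i).
Proof.
move=> Uu; rewrite /specmx !det_mulmx mulrAC -det_mulmx unitaryC // det1 mul1r.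
by rewrite det_diag; apply: eq_bigr => i _; rewrite mxE.
Qed.

Lemma psd_unit_gt0 (R : realType) (C : cplx R) n (A : 'M[C]_n) i :
  psd A -> A \in unitmx -> 0 < eigval A i.
Proof.
case=> Ah A0; rewrite unitmxE unitfE -{1}(specmx_eigval Ah).
rewrite det_specmx ?spectral_unitarymx // => /prodf_neq0 h.
by rewrite lt0r A0 andbT -(inj_eq (@ofR_inj _ C)) rmorph0 h.
Qed.

(** In the two eigenbases this is Young termwise, from k^r = (k z^(r-1))^r (z^r)^(1-r). *)
Lemma trp_le_variational (R : realType) (C : cplx R) n (K V : 'M[C]_n) z r :
  psd K -> V \is unitarymx -> (forall i, 0 < z i) -> 0 <= r -> r <= 1 ->
  ofR C (trp r K) <= ofR C r * \tr (K *m specmx V (fun i => z i `^ (r - 1)))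
    + ofR C ((1 - r) * \sum_i z i `^ r).
Proof.
move=> [Kh K0] Vu z0 r0 r1; set U := spectralmx K.
have Uu : U \is unitarymx by exact: spectral_unitarymx.
rewrite -{2}(specmx_eigval Kh) tr_specmxM -rmorphM -rmorphD ofR_le -/U.
have -> : trp r K = \sum_i \sum_j sqn ((U *m V ^t*) i j) * eigval K i `^ r.
  apply: eq_bigr => i _.
  by rewrite -mulr_suml unitary_row ?mul1r // unitaryM_tc.
have -> : \sum_i z i `^ r = \sum_i \sum_j sqn ((U *m V ^t*) i j) * z j `^ r.
  rewrite exchange_big; apply: eq_bigr => j _ /=.
  by rewrite -mulr_suml unitary_col ?mul1r // unitaryM_tc.
rewrite !mulr_sumr -!big_split; apply: ler_sum => i _ /=.
rewrite !mulr_sumr -!big_split; apply: ler_sum => j _ /=.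
rewrite !(mulrCA _ (sqn _)) -mulrDr; apply: ler_wpM2l; first exact: sqn_ge0.
have k0 := K0 i; have zj := z0 j; move: (eigval K i) (z j) k0 zj => k y k0 y0.
have y1 : 0 <= k * y `^ (r - 1) by rewrite mulr_ge0 ?powR_ge0.
apply: le_trans (young_powR y1 (powR_ge0 y r) r0 r1).
rewrite powRM ?powR_ge0 // -!powRrM -mulrA -powRD; last first.
  by rewrite (gt_eqF y0) implybT.
rewrite (_ : (r - 1) * r + r * (1 - r) = 0) ?powRr0 ?mulr1 //; ring.
Qed.

Lemma specmx_powM (R : realType) (C : cplx R) n (U : 'M[C]_n) a s t :
  U \is unitarymx -> (forall i, 0 < a i) ->
  specmx U (fun i => a i `^ s) *m specmx U (fun i => a i `^ t) =
  specmx U (fun i => a i `^ (s + t)).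
Proof.
move=> Uu a0; rewrite specmx_mul //; apply: eq_specmx => i.
by rewrite powRD // (gt_eqF (a0 i)) implybT.
Qed.

Lemma tr_specmx_pow_young (R : realType) (C : cplx R) n (U W : 'M[C]_n) a b s :
  U \is unitarymx -> W \is unitarymx ->
  (forall i, 0 < a i) -> (forall i, 0 < b i) -> 0 <= s -> s <= 1 ->
  \tr (specmx U (fun i => a i `^ s) *m specmx W (fun i => b i `^ (1 - s))) <=
  ofR C (s * \sum_i a i + (1 - s) * \sum_i b i).
Proof.
move=> Uu Wu a0 b0 s0 s1; rewrite tr_specmxM ofR_le.
have -> : \sum_i a i = \sum_i \sum_j sqn ((U *m W ^t*) i j) * a i.
  apply: eq_bigr => i _.
  by rewrite -mulr_suml unitary_row ?mul1r // unitaryM_tc.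
have -> : \sum_i b i = \sum_i \sum_j sqn ((U *m W ^t*) i j) * b j.
  rewrite exchange_big; apply: eq_bigr => j _ /=.
  by rewrite -mulr_suml unitary_col ?mul1r // unitaryM_tc.
rewrite !mulr_sumr -!big_split; apply: ler_sum => i _ /=.
rewrite !mulr_sumr -!big_split; apply: ler_sum => j _ /=.
rewrite !(mulrCA _ (sqn _)) -mulrDr; apply: ler_wpM2l; first exact: sqn_ge0.
by apply: young_powR => //; apply: ltW.
Qed.

Definition sandwich (R : realType) (C : cplx R) n (U W : 'M[C]_n)
    (a b : 'I_n -> R) (s t : R) : 'M[C]_n :=
  specmx W (fun i => b i `^ (t / 2)) *m specmx U (fun i => a i `^ s)
    *m specmx W (fun i => b i `^ (t / 2)).

Lemma psd_sandwich (R : realType) (C : cplx R) n (U W : 'M[C]_n)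
    (a b : 'I_n -> R) (s t : R) : U \is unitarymx -> (forall i, 0 < a i) ->
  psd (sandwich U W a b s t).
Proof.
move=> Uu a0; have := specmx_powM (s / 2) (s / 2) Uu a0; rewrite -splitr /sandwich.
have := (hermP _).1 (specmx_herm W (fun i => b i `^ (t / 2))).
have := (hermP _).1 (specmx_herm U (fun i => a i `^ (s / 2))).
move: (specmx U _) (specmx W _) (specmx U _) => A2 B A hA hB <-.
have -> : B *m (A *m A) *m B = (B *m A) *m (B *m A) ^t*.
  by rewrite tcM hA hB !mulmxA.
exact: psd_gram.
Qed.

Lemma char_poly_sandwich (R : realType) (C : cplx R) n (U W : 'M[C]_n)
    (a b : 'I_n -> R) (s t : R) : W \is unitarymx -> (forall i, 0 < b i) ->
  char_poly (sandwich U W a b s t) =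
  char_poly (specmx U (fun i => a i `^ s) *m specmx W (fun i => b i `^ t)).
Proof.
move=> Wu b0; rewrite /sandwich -mulmxA char_poly_mulC -mulmxA.
by rewrite (specmx_powM _ _ Wu b0) -splitr.
Qed.

Lemma trfun_sandwichC (R : realType) (C : cplx R) n (U W : 'M[C]_n)
    (a b : 'I_n -> R) (s t : R) f : U \is unitarymx -> W \is unitarymx ->
  (forall i, 0 < a i) -> (forall i, 0 < b i) ->
  trfun f (sandwich U W a b s t) = trfun f (sandwich W U b a t s).
Proof.
move=> Uu Wu a0 b0; apply: trfun_char.
- by case: (@psd_sandwich _ _ _ U W a b s t Uu a0).
- by case: (@psd_sandwich _ _ _ W U b a t s Wu b0).
by rewrite !char_poly_sandwich // char_poly_mulC.
Qed.

Lemma specmx_powN (R : realType) (C : cplx R) n (U : 'M[C]_n) a s :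
  U \is unitarymx -> (forall i, 0 < a i) ->
  specmx U (fun i => a i `^ s) *m specmx U (fun i => a i `^ (- s)) = 1%:M.
Proof.
move=> Uu a0; rewrite (specmx_powM _ _ Uu a0) subrr -(specmx1 Uu).
by apply: eq_specmx => i; rewrite powRr0.
Qed.

Lemma tr_sandwich (F : comNzRingType) n (A B Z : 'M[F]_n) :
  \tr (B *m A *m B *m Z) = \tr (A *m (B *m (Z *m B))).
Proof. by rewrite -!mulmxA mxtrace_mulC !mulmxA. Qed.

Lemma sandwich_inv (F : comNzRingType) n (A A' B B' : 'M[F]_n) :
  A *m A' = 1%:M -> B *m B' = 1%:M ->
  B *m A *m B *m (B' *m A' *m B') = 1%:M.
Proof.
move=> hA hB.
by rewrite -!mulmxA (mulmxA B B') hB mul1mx (mulmxA A A') hA mul1mx hB.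
Qed.

Lemma tr_sandwich_inv (F : comUnitRingType) n (A A' B B' : 'M[F]_n) :
  B *m B' = 1%:M ->
  \tr (B *m A *m B *m (B' *m A' *m B')) = \tr (A *m A').
Proof.
move=> hB; rewrite -!mulmxA (mulmxA B B') hB mul1mx mxtrace_mulC.
by rewrite -!mulmxA (mulmx1C hB) mulmx1.
Qed.

Lemma psd_inv (R : realType) (C : cplx R) n (N J : 'M[C]_n) :
  psd N -> N *m J = 1%:M -> (forall i, 0 < eigval N i) /\
  J = specmx (spectralmx N) (fun i => eigval N i `^ (-1)).
Proof.
move=> hN NJ; have n0 i : 0 < eigval N i.
  by apply: psd_unit_gt0 => //; case: (mulmx1_unit NJ).
split=> //.
have NN := specmx_powN 1 (spectral_unitarymx N) n0.
have eN : specmx (spectralmx N) (fun i => eigval N i `^ 1) = N := hpow1 hN.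
rewrite eN in NN; move: NN; move: (specmx _ _) => N' NN.
by rewrite -[J]mul1mx -(mulmx1C NN) -mulmxA NJ mulmx1.
Qed.

Section SandwichTrace.
Variables (R : realType) (C : cplx R) (n : nat).

(** Two separate exponents, because the induction lowers [s] alone; s = t = 1/p, applied to A^p and
    B^p, is the case p < 2 of [trp_amgm]. *)
Let bound (U W : 'M[C]_n) (a b : 'I_n -> R) (s t : R) :=
  (s + t) * trp (s + t)^-1 (sandwich U W a b s t) <=
  s * \sum_i a i + t * \sum_i b i.

(* Z = B^(s+t) in the variational bound. *)
Let bound_small U W a b s t : U \is unitarymx -> W \is unitarymx ->
  (forall i, 0 < a i) -> (forall i, 0 < b i) ->
  0 <= s -> s <= 1 -> 1 < s + t -> bound U W a b s t.
Proof.
move=> Uu Wu a0 b0 s0 s1 st1; rewrite /bound.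
have st0 : 0 < s + t by lra.
set r := (s + t)^-1.
have r0 : 0 <= r by rewrite invr_ge0 ltW.
have r1 : r <= 1 by rewrite invf_le1 // ltW.
have z0 i : 0 < b i `^ (s + t) by rewrite powR_gt0.
have := trp_le_variational (psd_sandwich W b s t Uu a0) Wu z0 r0 r1.
have -> : \sum_i (b i `^ (s + t)) `^ r = \sum_i b i.
  apply: eq_bigr => i _; rewrite -powRrM divff ?gt_eqF // powRr1 //.
  exact: ltW.
have -> : specmx W (fun i => (b i `^ (s + t)) `^ (r - 1)) =
    specmx W (fun i => b i `^ (1 - s - t)).
  apply: eq_specmx => i; rewrite -powRrM; congr (_ `^ _).
  by rewrite /r; field; rewrite gt_eqF.
rewrite /sandwich tr_sandwich !(specmx_powM _ _ Wu b0).
rewrite (_ : t / 2 + (1 - s - t + t / 2) = 1 - s); last by field.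
move=> h; have := tr_specmx_pow_young Uu Wu a0 b0 s0 s1.
rewrite -(ler_pM2l (_ : 0 < ofR C r)); last first.
  by rewrite lt0r ofR_ge0 r0 andbT fmorph_eq0 invr_eq0 gt_eqF.
move=> y; have := le_trans h (lerD y (lexx _)).
rewrite -!rmorphM -!rmorphD ofR_le => {h y}.
rewrite -(ler_pM2l st0) => h; apply: le_trans h _; rewrite le_eqVlt; apply/orP; left.
by apply/eqP; rewrite /r; field; rewrite gt_eqF.
Qed.

(* Z is chosen so that Z^(1-r) = B^(t/2) A^(s-1) B^(t/2), r = 1 / (s + t); then
   Tr (K Z^(r-1)) = Tr A. *)
Let bound_step U W a b s t : U \is unitarymx -> W \is unitarymx ->
  (forall i, 0 < a i) -> (forall i, 0 < b i) ->
  1 < s -> 1 < t -> bound U W a b (s - 1) t -> bound U W a b s t.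
Proof.
move=> Uu Wu a0 b0 s1 t1; rewrite /bound.
have e1 : s - 1 + t = s + t - 1 by ring.
rewrite e1; set N := sandwich U W a b (s - 1) t.
have st0 : 0 < s + t by lra.
have st1 : 0 < s + t - 1 by lra.
have hN : psd N by exact: psd_sandwich.
set J := sandwich U W a b (1 - s) (- t).
have [NJ trJ] : N *m J = 1%:M /\
    \tr (sandwich U W a b s t *m J) = ofR C (\sum_i a i).
  have hB := specmx_powN (t / 2) Wu b0; rewrite -mulNr in hB.
  split.
    have hA := specmx_powN (s - 1) Uu a0; rewrite opprB in hA.
    exact: sandwich_inv hA hB.
  rewrite (tr_sandwich_inv _ _ hB) (specmx_powM _ _ Uu a0).
  rewrite (_ : s + (1 - s) = 1); last by ring.
  rewrite tr_specmx //; congr (ofR C _).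
  by apply: eq_bigr => i _; rewrite powRr1 ?ltW.
have [n0 eJ] := psd_inv hN NJ.
set V := spectralmx N in eJ; set nu := eigval N in n0 eJ *.
have Vu : V \is unitarymx by exact: spectral_unitarymx.
pose r := (s + t)^-1.
have r0 : 0 <= r by rewrite invr_ge0 ltW.
have r1 : r <= 1 by rewrite invf_le1 //; lra.
(* For Z = N^c: c (r - 1) = -1 makes Z^(r-1) the inverse [J], and c r = 1/(s + t - 1) makes Tr Z^r
   the trace in the induction hypothesis. *)
pose c := (s + t) / (s + t - 1).
have z0 i : 0 < nu i `^ c by rewrite powR_gt0.
have := trp_le_variational (psd_sandwich W b s t Uu a0) Vu z0 r0 r1.
have -> : \sum_i (nu i `^ c) `^ r = trp (s + t - 1)^-1 N.
  apply: eq_bigr => i _; rewrite -powRrM; congr (_ `^ _).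
  by rewrite /c /r; field; rewrite !gt_eqF.
have -> : specmx V (fun i => (nu i `^ c) `^ (r - 1)) = J.
  rewrite eJ; apply: eq_specmx => i; rewrite -powRrM; congr (_ `^ _).
  by rewrite /c /r; field; rewrite !gt_eqF.
rewrite trJ -rmorphM -rmorphD ofR_le /r.
move: (trp _ _) (trp _ _) (\sum_i a i) (\sum_i b i) => y x al be h k.
have := ler_wpM2l (ltW st0) h.
have -> : (s + t) * ((s + t)^-1 * al + (1 - (s + t)^-1) * y) =
    al + (s + t - 1) * y by field; rewrite gt_eqF.
move=> {}h; apply: le_trans h _; move: k; lra.
Qed.

Lemma trp_sandwich_le U W a b s t : U \is unitarymx -> W \is unitarymx ->
  (forall i, 0 < a i) -> (forall i, 0 < b i) ->
  0 <= s -> 0 <= t -> 1 < s + t -> bound U W a b s t.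
Proof.
move=> Uu Wu a0 b0 s0 t0 st.
have [k] : exists k, s <= k%:R by exists (Num.bound s); apply/ltW/archi_boundP.
elim: k s s0 st => [|k IH] s s0 st sk.
  by apply: bound_small => //; apply: le_trans sk ler01.
have [s1|s1] := leP s 1; first exact: bound_small.
have [t1|t1] := leP t 1.
  (* The products A^s B^t and B^t A^s share their spectrum, so the roles of (A, s) and (B, t) can be
     exchanged. *)
  rewrite /bound trfun_sandwichC // addrC [leRHS]addrC; apply: bound_small => //.
  by rewrite addrC.
apply: bound_step => //; apply: IH; first by lra.
  by lra.
by rewrite lerBlDr natr1.
Qed.
End SandwichTrace.

Lemma trp_amgm (R : realType) (C : cplx R) n (U W K : 'M[C]_n) a b p :
  U \is unitarymx -> W \is unitarymx ->
  (forall i, 0 < a i) -> (forall i, 0 < b i) -> 0 < p ->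
  K \is hermsymmx -> char_poly K = char_poly (specmx U a *m specmx W b) ->
  2 * trp (p / 2) K <= \sum_i a i `^ p + \sum_i b i `^ p.
Proof.
move=> Uu Wu a0 b0 p0 Kh cK.
have [p2|p2] := ltP p 2.
  have ap0 i : 0 < a i `^ p by rewrite powR_gt0.
  have bp0 i : 0 < b i `^ p by rewrite powR_gt0.
  have pV0 : 0 < p^-1 by rewrite invr_gt0.
  have pV2 : 1 < p^-1 + p^-1.
    by rewrite -mulr2n -mulr_natr mulrC ltr_pdivlMr // mul1r.
  have rr x : 0 < x -> (x `^ p) `^ p^-1 = x.
    by move=> x0; rewrite -powRrM divff ?gt_eqF // powRr1 // ltW.
  have := trp_sandwich_le Uu Wu ap0 bp0 (ltW pV0) (ltW pV0) pV2.
  have -> : trp (p^-1 + p^-1)^-1 (sandwich U W (fun i => a i `^ p)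
      (fun i => b i `^ p) p^-1 p^-1) = trp (p / 2) K.
    have -> : (p^-1 + p^-1)^-1 = p / 2 by field; rewrite gt_eqF.
    have cS := char_poly_sandwich U (fun i => a i `^ p) p^-1 p^-1 Wu bp0.
    have eA : specmx U (fun i => (a i `^ p) `^ p^-1) = specmx U a.
      by apply: eq_specmx => i; apply: rr.
    have eB : specmx W (fun i => (b i `^ p) `^ p^-1) = specmx W b.
      by apply: eq_specmx => i; apply: rr.
    rewrite eA eB -cK in cS; apply: trfun_char cS => //.
    by case: (psd_sandwich W (fun i => b i `^ p) p^-1 p^-1 Uu ap0).
  move: (trp _ _) (\sum_i a i `^ p) (\sum_i b i `^ p) => x y z h.
  have := ler_wpM2l (ltW p0) h; congr (_ <= _); field; exact: lt0r_neq0.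
(* For p >= 2, the diagonal m_k of A B in a Schur basis satisfies m_k^2 <= (A^2)_kk (B^2)_kk; the
   arithmetic-geometric mean inequality on powers p / 2 and Peierls for A^2 and B^2 conclude. *)
have hS : psd (sandwich U W a b 1 1) by exact: psd_sandwich.
have cS := char_poly_sandwich U a 1 1 Wu b0.
have e1 (V : 'M[C]_n) (c : 'I_n -> R) : (forall i, 0 < c i) ->
    specmx V (fun i => c i `^ 1) = specmx V c.
  by move=> c0; apply: eq_specmx => i; exact: powRr1 (ltW (c0 i)).
rewrite (e1 U a a0) (e1 W b b0) in cS.
have [V [Vu m0 trV]] := schur_psd hS (esym cS).
have p1 : 1 <= p / 2 by lra.
have -> : trp (p / 2) K = trp (p / 2) (sandwich U W a b 1 1).
  by rewrite (trfun_char _ Kh (proj1 hS) (etrans cK (esym cS))).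
rewrite trV mulr_sumr => {cS cK hS trV e1}.
have sq (Q : 'M[C]_n) (c : 'I_n -> R) : Q \is unitarymx -> (forall i, 0 < c i) ->
    \sum_k dgl V (specmx Q c *m specmx Q c) k `^ (p / 2) <= \sum_i c i `^ p.
  move=> Qu c0; rewrite specmx_mul //.
  have c2 i : 0 <= c i * c i by rewrite mulr_ge0 // ltW.
  apply: le_trans (peierls_ge1 (psd_specmx Q c2) Vu p1) _.
  rewrite trfun_specmx //; apply: ler_sum => i _.
  by rewrite -expr2 powR_sqr_half gtr0_norm.
apply: le_trans (lerD (sq _ _ Uu a0) (sq _ _ Wu b0)).
rewrite -big_split; apply: ler_sum => k _ /=.
have := dgl_cauchy_schwarz V (specmx U a) (specmx W b) k.
rewrite ((hermP _).1 (specmx_herm U a)) ((hermP _).1 (specmx_herm W b)) => h.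
have := m0 k.
have x0 : 0 <= dgl V (specmx U a *m specmx U a) k.
  by rewrite specmx_mul; [apply/dgl_ge0/psd_specmx => i; rewrite mulr_ge0 // ltW | ].
have y0 : 0 <= dgl V (specmx W b *m specmx W b) k.
  by rewrite specmx_mul; [apply/dgl_ge0/psd_specmx => i; rewrite mulr_ge0 // ltW | ].
move: h x0 y0.
move: (dgl _ _ _) (dgl _ _ _) (dgl _ _ _) => y x m h x0 y0 mk.
have e : (m `^ (p / 2)) ^+ 2 <= x `^ (p / 2) * y `^ (p / 2).
  have p20 : 0 <= p / 2 by lra.
  rewrite -powRM // -powR_mulrn ?powR_ge0 // -powRrM mulrC powRrM powR_mulrn //.
  by apply: ge0_ler_powR => //; rewrite nnegrE ?sqr_ge0 ?mulr_ge0.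
have := powR_ge0 m (p / 2); have := powR_ge0 x (p / 2); have := powR_ge0 y (p / 2).
move: (m `^ _) (x `^ _) (y `^ _) e => u v w e w0 v0 u0.
have := sqr_ge0 (v - w) => sq2.
rewrite -(ler_pXn2r (_ : 0 < 2)%N) ?nnegrE ?addr_ge0 ?mulr_ge0 //.
move: sq2 e; nra.
Qed.

Lemma powR_midpoint_lt0 (R : realType) (q x y : R) : q < 0 -> 0 < x -> 0 < y ->
  2 * (x + y) `^ q <= 2 `^ q * (x `^ q + y `^ q).
Proof.
move=> q0 x0 y0; pose m := (x + y) / 2.
have m0 : 0 < m by rewrite divr_gt0 // addr_gt0.
have -> : x + y = 2 * m by rewrite /m; field.
rewrite (powRM _ (ler0n _ 2) (ltW m0)) mulrCA; apply: ler_wpM2l; first exact: powR_ge0.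
have hx := powR_tangent_lt0 q0 x0 m0; have hy := powR_tangent_lt0 q0 y0 m0.
by have := lerD hx hy; congr (_ <= _); rewrite /m; field.
Qed.

Lemma trp_add_lt0 (R : realType) (C : cplx R) n (A B : 'M[C]_n) q :
  A \is hermsymmx -> B \is hermsymmx ->
  (forall i, 0 < eigval A i) -> (forall i, 0 < eigval B i) -> q < 0 ->
  2 * trp q (A + B) <= 2 `^ q * (trp q A + trp q B).
Proof.
move=> Ah Bh A0 B0 q0; have Sh := hermD Ah Bh.
have Eu := spectral_unitarymx (A + B).
have hA := peierls_lt0 Ah A0 Eu q0; have hB := peierls_lt0 Bh B0 Eu q0.
apply: le_trans (ler_wpM2l (powR_ge0 2 q) (lerD hA hB)).
rewrite -big_split /= !mulr_sumr; apply: ler_sum => k _.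
rewrite -(dgl_eigval k Sh) dglD.
by apply: powR_midpoint_lt0 => //; apply: dgl_gt0.
Qed.

Lemma trp_add_sandwich_lt0 (R : realType) (C : cplx R) n (A B : 'M[C]_n) q :
  A \is hermsymmx -> B \is hermsymmx ->
  (forall i, 0 < eigval A i) -> (forall i, 0 < eigval B i) -> q < 0 ->
  trp q (A + B) <= trp q A + trp q B +
    (2 `^ q - 2) * trp (q / 2) (hpow A (1 / 2) *m B *m hpow A (1 / 2)).
Proof.
move=> Ah Bh A0 B0 q0.
have h := trp_add_lt0 Ah Bh A0 B0 q0.
have c2 : 2 `^ q <= 2.
  rewrite -[leRHS]powRr1 //; apply: ler_powR; first by rewrite ler1n.
  by apply: ltW; apply: lt_trans q0 _.
set K := hpow A (1 / 2) *m B *m hpow A (1 / 2).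
set U := spectralmx A; set W := spectralmx B.
have Uu : U \is unitarymx := spectral_unitarymx A.
have Wu : W \is unitarymx := spectral_unitarymx B.
set a := eigval A in A0; set b := eigval B in B0.
have eK : K = sandwich W U b a 1 1.
  have eB : specmx W (fun i => b i `^ 1) = B.
    by apply: hpow1; split=> // i; apply/ltW.
  by rewrite /sandwich eB.
have hK : psd K by rewrite eK; apply: psd_sandwich.
(* [J] is the inverse of [K], so Tr K^(q/2) = Tr J^(-q/2), and [trp_amgm] applies to the inverses of
   A and B with p = -q. *)
set J := sandwich W U b a (- 1) (- 1).
have KJ : K *m J = 1%:M.
  have hB := specmx_powN 1 Wu B0.
  have hA := specmx_powN (1 / 2) Uu A0; rewrite -mulNr in hA.
  by rewrite eK; apply: sandwich_inv hB hA.
have [K0 eJ] := psd_inv hK KJ.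
have tJ : trp (- q / 2) J = trp (q / 2) K.
  rewrite eJ trfun_specmx ?spectral_unitarymx //; apply: eq_bigr => i _.
  by rewrite -powRrM; congr (_ `^ _); field.
have Jh : J \is hermsymmx by rewrite eJ; apply: specmx_herm.
have cJ := char_poly_sandwich W b (-1) (-1) Uu A0.
have bV i : 0 < b i `^ (-1) by rewrite powR_gt0.
have aV i : 0 < a i `^ (-1) by rewrite powR_gt0.
have p0 : 0 < - q by rewrite oppr_gt0.
have eV (D : 'M[C]_n) :
    \sum_i (eigval D i `^ (-1)) `^ (- q) = trp q D.
  by apply: eq_bigr => i _; rewrite -powRrM mulrNN mul1r.
have k : 2 * trp (q / 2) K <= trp q B + trp q A.
  have := trp_amgm Wu Uu bV aV p0 Jh cJ; rewrite tJ.
  congr (_ <= _ + _); exact: eV.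
move: h c2 k; move: (trp q (A + B)) (trp q A) (trp q B) (trp (q / 2) K) (2 `^ q).
clear=> s x y z c h c2 k.
(* Adding this product to the right side of [h] gives exactly twice the right side of the goal. *)
have : 0 <= (2 - c) * (y + x - 2 * z) by rewrite mulr_ge0 // subr_ge0.
nra.
Qed.

Lemma trp_add_sandwich_ge2 (R : realType) (C : cplx R) n (A B : 'M[C]_n) q :
  psd A -> psd B -> 2 <= q ->
  trp q A + trp q B +
    (2 `^ q - 2) * trp (q / 2) (hpow A (1 / 2) *m B *m hpow A (1 / 2))
  <= trp q (A + B).
Proof.
move=> pA pB q2.
have e (D : 'M[C]_n) : psd D -> hpow D (1 / 2) *m hpow D (1 / 2) = D.
  by move=> pD; rewrite (hpow_half _ ler01) hpow1.
have := @blk_ge2 R C q q2 n (hpow A (1 / 2)) (hpow B (1 / 2)).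
have := e A pA; have := e B pB; have := hpow_tc A (1 / 2); have := hpow_tc B (1 / 2).
move: (hpow A _) (hpow B _) => X Y hY hX <- <-.
by rewrite tcM !hX hY !mulmxA.
Qed.

(** * Transfer to the concrete complex field *)

(** A copy of [hermfun] over the abstract interface; at [complex_cplx] the two are convertible, so
    that [exact] closes the final statement. *)
Definition hermfunc (R : realType) (C : cplx R) n (f : R -> R) (A : 'M[C]_n) :
    'M[C]_n :=
  invmx (spectralmx A)
    *m diag_mx (map_mx (fun z : C => ofR C (f (reR z))) (spectral_diag A))
    *m spectralmx A.

Lemma hermfunc_specmx (R : realType) (C : cplx R) n f (A : 'M[C]_n) :
  hermfunc f A = specmx (spectralmx A) (fun i => f (eigval A i)).
Proof.
rewrite /hermfunc invmx_unitary ?spectral_unitarymx // /specmx.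
congr (_ *m diag_mx _ *m _); apply/rowP => i; rewrite !mxE; by [].
Qed.

Lemma tr_hermfunc (R : realType) (C : cplx R) n f (A : 'M[C]_n) :
  \tr (hermfunc f A) = ofR C (trfun f A).
Proof. by rewrite hermfunc_specmx tr_specmx ?spectral_unitarymx. Qed.

Lemma quad_dgl (R : realType) (C : cplx R) n (V A : 'M[C]_n) k :
  A \is hermsymmx ->
  (((row k V) ^t*) ^t* *m A *m (row k V) ^t*) 0 0 = ofR C (dgl V A k).
Proof.
move=> Ah; rewrite dgl_ofR // trmxCK -row_mul !mxE; apply: eq_bigr => i _.
by rewrite !mxE.
Qed.

Lemma posdef_eigval_gt0 (R : realType) (C : cplx R) n (A : 'M[C]_n) k :
  A \is hermsymmx ->
  (forall v : 'cV[C]_n, v != 0 -> 0 < (v ^t* *m A *m v) 0 0) ->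
  0 < eigval A k.
Proof.
move=> Ah H; rewrite -(dgl_eigval k Ah) lt0r -(inj_eq (@ofR_inj _ C)) rmorph0.
rewrite -(ofR_ge0 C) -lt0r -quad_dgl //; apply: H.
have Vu := spectral_unitarymx A.
apply/eqP => /matrixP h; have := oner_eq0 R.
rewrite -(unitary_row k Vu) big1 ?eqxx // => i _.
by have := h i 0; rewrite !mxE => e; rewrite -sqn_conj e sqn0.
Qed.

Lemma possemidef_psd (R : realType) (C : cplx R) n (A : 'M[C]_n) :
  A \is hermsymmx -> (forall v : 'cV[C]_n, 0 <= (v ^t* *m A *m v) 0 0) -> psd A.
Proof.
move=> Ah H; apply: psd_dgl => // V k _.
by rewrite -(ofR_ge0 C) -quad_dgl.
Qed.

Lemma tr_add_lt0 (R : realType) (C : cplx R) n (A B : 'M[C]_n) :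
  A \is hermsymmx /\
    (forall v : 'cV[C]_n, v != 0 -> 0 < (v ^t* *m A *m v) 0 0) ->
  B \is hermsymmx /\
    (forall v : 'cV[C]_n, v != 0 -> 0 < (v ^t* *m B *m v) 0 0) ->
  let P q (D : 'M[C]_n) := hermfunc (fun x => x `^ q) D in
  forall q, q < 0 ->
  \tr (P q (A + B)) <= \tr (P q A) + \tr (P q B) +
    ofR C (2 `^ q - 2) * \tr (P (q / 2) (P (1 / 2) A *m B *m P (1 / 2) A)).
Proof.
move=> [Ah A0] [Bh B0] P q q0; rewrite /P !tr_hermfunc hermfunc_specmx.
rewrite -rmorphM -!rmorphD ofR_le; apply: trp_add_sandwich_lt0 => // i.
  exact: posdef_eigval_gt0.
exact: posdef_eigval_gt0.
Qed.

Lemma tr_add_ge2 (R : realType) (C : cplx R) n (A B : 'M[C]_n) :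
  A \is hermsymmx /\ (forall v : 'cV[C]_n, 0 <= (v ^t* *m A *m v) 0 0) ->
  B \is hermsymmx /\ (forall v : 'cV[C]_n, 0 <= (v ^t* *m B *m v) 0 0) ->
  let P q (D : 'M[C]_n) := hermfunc (fun x => x `^ q) D in
  forall q, 2 <= q ->
  \tr (P q A) + \tr (P q B) +
    ofR C (2 `^ q - 2) * \tr (P (q / 2) (P (1 / 2) A *m B *m P (1 / 2) A))
  <= \tr (P q (A + B)).
Proof.
move=> [Ah A0] [Bh B0] P q q2; rewrite /P !tr_hermfunc hermfunc_specmx.
rewrite -rmorphM -!rmorphD ofR_le; apply: trp_add_sandwich_ge2 => //.
  exact: possemidef_psd.
exact: possemidef_psd.
Qed.

Definition complex_cplx (R : realType) : cplx R :=
  @Cplx R R[i] (real_complex R) (@complex.Re R)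
    (fun a => lecR 0 a) (@complexRe R).

Local Open Scope complex_scope.

Theorem theorem1p1 (R : realType) (n : nat) (hn : (1 <= n)%N)
    (A B : 'M[R[i]]_n) :
  (posdefmx A -> posdefmx B -> forall q : R, q < 0 ->
     \tr (mxpowR (A + B) q) <=
       \tr (mxpowR A q) + \tr (mxpowR B q)
       + (2 `^ q - 2)%:C *
         \tr (mxpowR (mxpowR A (1 / 2) *m B *m mxpowR A (1 / 2)) (q / 2)))
  /\
  (possemidefmx A -> possemidefmx B -> forall q : R, 2 <= q ->
     \tr (mxpowR (A + B) q) >=
       \tr (mxpowR A q) + \tr (mxpowR B q)
       + (2 `^ q - 2)%:C *
         \tr (mxpowR (mxpowR A (1 / 2) *m B *m mxpowR A (1 / 2)) (q / 2))).
Proof.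
split.
  exact: (@tr_add_lt0 R (complex_cplx R) n A B).
exact: (@tr_add_ge2 R (complex_cplx R) n A B).
Qed.
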